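(* Let $m>0$ and let $T^{TM}$ and $T^{tct}$ be the POL of the massive scalar boson of mass $m$ with kernels $$t^{TM}(k,p)=\frac12\left(1+\frac{m^2+kp}{\epsilon(k)\epsilon(p)}\right),$$ $$t^{tct}(k,p)=\frac12\Big(\epsilon(k)(m+\epsilon(k))\,\epsilon(p)(m+\epsilon(p))\Big)^{-1/2}\Big((m+\epsilon(k))(m+\epsilon(p))+kp\Big),$$ respectively. Then $T^{TM}$ and $T^{tct}$ are separated, i.e. $\|T(B)\|=1$ for every nonempty open ball $B\subset\mathbb{R}^3$. Moreover, for $T$ either of them with kernel $t$, every $k_0\in\mathbb{R}^3\setminus\{0\}$ and every $b\in\mathbb{R}^3$, $$\phi_n(p):=c_n\,e^{-ibp}\,e^{-|p|^2/n^2}\,t(k_0,p),$$ with $c_n>0$ the normalizing constant, is a sequence of states localized at $b$: $\langle\phi_n,T(B)\phi_n\rangle\to1$ as $n\to\infty$ for every open ball $B$ around $b$.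
   Context: Put $\epsilon(p)=\sqrt{m^2+|p|^2}$; $kp$ is the Euclidean scalar product. A POL of the massive scalar boson is a normalized positive operator valued measure $T$ on the Borel sets of $\mathbb{R}^3$ ($T(\mathbb{R}^3)=I$), with values in operators on $L^2(\mathbb{R}^3)$, which is covariant, $U^{(0)}(g)T(\Delta)U^{(0)}(g)^{-1}=T(g\cdot\Delta)$, with respect to the representation $(U^{(0)}(b,B)\phi)(p)=e^{-ibp}\phi(B^{-1}\cdot p)$ of the covering group $ISU(2)$ of the Euclidean group. It has kernel $t$ if for $\phi\in L^1\cap L^2$ and measurable $\Delta\subset\mathbb{R}^3$ $$\langle\phi,T(\Delta)\phi\rangle=(2\pi)^{-3}\int_\Delta\int\int t(k,p)e^{i(p-k)x}\overline{\phi(k)}\phi(p)\,d^3k\,d^3p\,d^3x,$$ and $T$ is determined by its kernel. *)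

(* Defs.v *)
From HB Require Import structures.
From mathcomp Require Import all_boot all_order all_algebra.
From mathcomp Require Import spectral.
From mathcomp Require Import complex.
From mathcomp Require Import all_classical all_reals all_analysis.

Set Implicit Arguments.
Unset Strict Implicit.
Unset Printing Implicit Defensive.
Import Order.TTheory GRing.Theory Num.Theory.
Import numFieldNormedType.Exports.

Local Open Scope classical_set_scope.
Local Open Scope ring_scope.
Local Open Scope complex_scope.

(* R^3 is the iterated product ((x1, x2), x3), whose measurable sets are the
   Borel sets of R^3. *)
Notation R3 R :=
  (measurableTypeR R * measurableTypeR R * measurableTypeR R)%type.

Section Space.
Context {R : realType}.
Implicit Types (p q x b : R3 R).

Definition vol : set (R3 R) -> \bar R :=
  ((@lebesgue_measure R \x @lebesgue_measure R) \x @lebesgue_measure R)%E.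

HB.instance Definition _ := Measure.on vol.

Let vol_sigma_finite : sigma_finite setT vol.
Proof.
have /sigma_finiteP[F [TF ndF Foo]] := sigma_finiteT (@lebesgue_measure R).
exists (fun n => F n `*` F n `*` F n).
  rewrite -setXTT -(setXTT (measurableTypeR R)) TF predeqE => -[[x y] z]; split.
    move=> [[[i _ Fx] [j _ Fy]] [k _ Fz]] /=.
    have sF l : (l <= maxn i (maxn j k))%N -> F l `<=` F (maxn i (maxn j k)).
      by move=> le_l; exact/subsetPset/ndF.
    exists (maxn i (maxn j k)) => //; split; [split|] => /=.
    - by apply: (sF i); rewrite // leq_maxl.
    - by apply: (sF j); rewrite // !leq_max leqnn orbT.
    - by apply: (sF k); rewrite // !leq_max leqnn !orbT.
  by move=> [n _ [[? ?] ?]]; split; [split|]; exists n.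
move=> n; have [mF Fn] := Foo n.
split; first by do 2 apply: measurableX => //.
rewrite /vol product_measure1E//; last exact: measurableX.
rewrite [X in (X * _)%E]product_measure1E// lte_mul_pinfty//.
- by rewrite mule_ge0.
- by rewrite ge0_fin_numE ?mule_ge0// lte_mul_pinfty// ge0_fin_numE.
Qed.
HB.instance Definition _ :=
  Measure_isSigmaFinite.Build _ _ _ vol vol_sigma_finite.

Definition dot3 p q : R := p.1.1 * q.1.1 + p.1.2 * q.1.2 + p.2 * q.2.

Definition norm3 p : R := Num.sqrt (dot3 p p).

Definition open_ball b (r : R) : set (R3 R) := [set x | norm3 (x - b) < r].

Definition cis (a : R) : R[i] := cos a +i* sin a.

(* The two-fold covering SU(2) -> SO(3): B . p is the vector with
   sigma(B . p) = B sigma(p) B^*, where sigma(p) = sum_j p_j sigma_j. *)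
Definition SU2 (B : 'M[R[i]]_2) : Prop := B \is unitarymx /\ \det B = 1.

Definition pauli p : 'M[R[i]]_2 := \matrix_(i, j)
  if (i == 0) && (j == 0) then p.2%:C
  else if i == 0 then p.1.1 -i* p.1.2
  else if j == 0 then p.1.1 +i* p.1.2
  else (- p.2)%:C.

Definition unpauli (M : 'M[R[i]]_2) : R3 R :=
  (complex.Re (M 1 0), complex.Im (M 1 0), complex.Re (M 0 0)).

Definition SU2_act (B : 'M[R[i]]_2) p : R3 R :=
  unpauli (B *m pauli p *m map_mx Num.conj B^T).

(* (b, B) in ISU(2) acts on R^3 by x |-> b + B . x. *)
Definition isu2_act b (B : 'M[R[i]]_2) x : R3 R := b + SU2_act B x.

End Space.

Section Hilbert.
Context {R : realType}.
Notation V := (R3 R).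
Notation C := R[i].

(* Elements of L^p(R^3) are represented by complex-valued functions, to be
   identified when they agree almost everywhere. *)
Definition cnorm (p : \bar R) (phi : V -> C) : \bar R :=
  Lnorm vol p (fun k => (ComplexField.Normc.normc (phi k))%:E).

Definition cLfun (p : \bar R) (phi : V -> C) : Prop :=
  [/\ measurable_fun setT (fun k => complex.Re (phi k)),
      measurable_fun setT (fun k => complex.Im (phi k)) &
      (cnorm p phi < +oo)%E].

Definition cint (D : set V) (f : V -> C) : C :=
  (\int[vol]_(x in D) complex.Re (f x)) +i* (\int[vol]_(x in D) complex.Im (f x)).

Definition inner (phi psi : V -> C) : C :=
  cint setT (fun k => (phi k)^* * psi k).

Definition aeq (phi psi : V -> C) : Prop := {ae vol, forall k, phi k = psi k}.

(* Bounded operators on L^2(R^3), acting on representatives; compatibility with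
   almost everywhere equality makes them operators on the quotient. *)
Record bounded_operator (A : (V -> C) -> (V -> C)) : Prop := {
  op_L2 : forall phi, cLfun 2%:E phi -> cLfun 2%:E (A phi);
  op_ae : forall phi psi, cLfun 2%:E phi -> cLfun 2%:E psi ->
    aeq phi psi -> aeq (A phi) (A psi);
  op_linear : forall (a : C) phi psi, cLfun 2%:E phi -> cLfun 2%:E psi ->
    aeq (A (fun k => a * phi k + psi k)) (fun k => a * A phi k + A psi k);
  op_bounded : exists K : R, forall phi, cLfun 2%:E phi ->
    (cnorm 2%:E (A phi) <= K%:E * cnorm 2%:E phi)%E
}.

Definition opnorm (A : (V -> C) -> (V -> C)) : \bar R :=
  ereal_sup [set cnorm 2%:E (A phi) |
    phi in [set phi | cLfun 2%:E phi /\ (cnorm 2%:E phi <= 1)%E]].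

Definition Urep (b : V) (B : 'M[C]_2) (phi : V -> C) : V -> C :=
  fun p => cis (- dot3 b p) * phi (SU2_act (invmx B) p).

(* U(g)^-1 = U(g^-1) with (b, B)^-1 = (- B^-1 . b, B^-1). *)
Definition Urep_inv (b : V) (B : 'M[C]_2) : (V -> C) -> (V -> C) :=
  Urep (- SU2_act (invmx B) b) (invmx B).

(* In the order of R[i], [0 <= z] says that z is real and nonnegative; the
   family T is only meaningful on measurable sets. Countable additivity is meant
   in the weak operator topology. *)
Record POL (T : set V -> (V -> C) -> (V -> C)) : Prop := {
  POL_bounded : forall D, measurable D -> bounded_operator (T D);
  POL_positive : forall D, measurable D -> forall phi, cLfun 2%:E phi ->
    0 <= inner phi (T D phi);
  POL_sigma_additive : forall F : nat -> set V,
    (forall n, measurable (F n)) -> trivIset setT F ->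
    forall phi psi, cLfun 2%:E phi -> cLfun 2%:E psi ->
    (fun n => \sum_(i < n) inner phi (T (F i) psi) : C^o) @ \oo
      --> (inner phi (T (\bigcup_n F n) psi) : C^o);
  POL_normalized : forall phi, cLfun 2%:E phi -> aeq (T setT phi) phi;
  POL_covariant : forall b B, SU2 B -> forall D, measurable D ->
    forall phi, cLfun 2%:E phi ->
    aeq (Urep b B (T D (Urep_inv b B phi))) (T (isu2_act b B @` D) phi)
}.

(* The integrals are total (0 when divergent). For a bounded measurable kernel
   of positive type and phi in L^1 and L^2, the inner double integral converges
   absolutely and is a nonnegative function of x. *)
Definition has_kernel (T : set V -> (V -> C) -> (V -> C)) (t : V -> V -> C) :=
  forall phi, cLfun 1%:E phi -> cLfun 2%:E phi ->
  forall D, measurable D ->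
  inner phi (T D phi) = ((2 * pi) ^- 3)%:C *
    cint D (fun x => cint setT (fun p => cint setT (fun k =>
      t k p * cis (dot3 (p - k) x) * (phi k)^* * phi p))).

Definition POL_separated (T : set V -> (V -> C) -> (V -> C)) : Prop :=
  forall (b : V) (r : R), 0 < r -> opnorm (T (open_ball b r)) = 1%E.

Definition is_state (phi : V -> C) : Prop :=
  cLfun 2%:E phi /\ cnorm 2%:E phi = 1%E.

Definition localized_at (T : set V -> (V -> C) -> (V -> C)) (b : V)
    (phi : nat -> V -> C) : Prop :=
  forall r : R, 0 < r ->
  (fun n => inner (phi n) (T (open_ball b r) (phi n)) : C^o) @ \oo
    --> (1 : C^o).

End Hilbert.

Section Kernels.
Context {R : realType}.
Variable m : R.
Notation V := (R3 R).
Implicit Types (k p : V).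

Definition energy p : R := Num.sqrt (m ^+ 2 + norm3 p ^+ 2).

Definition tTM k p : R :=
  2^-1 * (1 + (m ^+ 2 + dot3 k p) / (energy k * energy p)).

Definition ttct k p : R :=
  2^-1 * (Num.sqrt (energy k * (m + energy k) * (energy p * (m + energy p))))^-1
    * ((m + energy k) * (m + energy p) + dot3 k p).

End Kernels.

Section Sequence.
Context {R : realType}.
Notation V := (R3 R).
Variables (t : V -> V -> R) (k0 b : V).

Definition loc_raw (n : nat) : V -> R[i] := fun p =>
  cis (- dot3 b p) * (expR (- (norm3 p ^+ 2 / n%:R ^+ 2)) * t k0 p)%:C.

(* The Gaussian width n is meaningful for n > 0 only. *)
Definition loc_const (n : nat) : R := (fine (cnorm 2%:E (loc_raw n)))^-1.

Definition loc_seq (n : nat) : V -> R[i] := fun p =>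
  (loc_const n)%:C * loc_raw n p.

End Sequence.

(* Main.v *)
(* Both kernels have the form t(k,p) = sum_j w_j(k) w_j(p) with sum_j w_j^2 = 1,
   so for a state phi(p) = e^(-ibp) f(p) with f real, <phi, T(D) phi> is the
   integral over D of a nonnegative density rho(x), the Fourier transform of
   t(k,p) f(k) f(p) along p - k, centred at b.  The localization is tested
   with the weight W(x) = e^(-|x1|-|x2|-|x3|), whose Fourier transform
   K(h) = prod_i 2/(1+h_i^2) is explicit: by Tonelli,
     int W(x-b) rho(x) dx = int K(h) int t(k,k+h) f(k) f(k+h) dk dh,
   and W <= e^(-r) off the ball of radius r bounds the mass outside it.  The
   total mass of rho is known from T(R^3) = I, which replaces Plancherel.
   For f = f_n a normalized Gaussian of width n times t(k0,.), the inner
   integral tends to 1 for every h, because 1 - t(k,k+h) = O(|h|^2/|k|) and the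
   Gaussian mass spreads to infinity; dominated convergence then sends the
   right-hand side to int K = (2 pi)^3.  Finally ||T(B)|| <= 1 follows from
   0 <= T(B) <= I, and ||T(B)|| >= 1 from the localized sequence. *)

From HB Require Import structures.
Require Import Defs.
From mathcomp Require Import all_boot all_order all_algebra.
From mathcomp Require Import complex.
From mathcomp Require Import all_classical all_reals all_analysis.
From mathcomp Require Import measurable_realfun ring lra.
Import Order.TTheory GRing.Theory Num.Theory.
Import numFieldNormedType.Exports.

Set Implicit Arguments.
Unset Strict Implicit.
Unset Printing Implicit Defensive.

Local Open Scope classical_set_scope.
Local Open Scope ring_scope.
Local Open Scope complex_scope.

(** Interchanging the position and momentum integrals is the delicate point, since the integrand
    oscillates. Everything is therefore kept nonnegative: [1 + cos] replaces [cos], so that Tonelli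
    applies, and the extra term, the finite number [8 * density 0], is cancelled afterwards. The
    same device gives the measurability of the density. The real-valued integral is 0 when it
    diverges, so the density is not known in advance to be integrable; that its total integral is
    the nonzero number (2 pi)^3 is what certifies it. Both kernels enter only through
    [slowly_varying_kernel]. The bound [svk_lower] makes the profile mass comparable to the Gaussian
    mass uniformly in n. The decay estimate is used outside a cube of half-side sqrt n, where it
    leaves an error of order n^(-1/2); the cube itself has volume of order n^(3/2), negligible
    against a Gaussian mass of order at least n^3. No exact Gaussian integral is computed. *)

Section leb2.
Context {R : realType}.

(** The inner factor of [vol], named so that it can carry the sigma-finite structure that Tonelli
    requires when the third coordinate is split off. *)
Definition leb2 : set (measurableTypeR R * measurableTypeR R) -> \bar R :=
  (@lebesgue_measure R \x @lebesgue_measure R)%E.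

HB.instance Definition _ := Measure.on leb2.

Let leb2_sigma_finite : sigma_finite setT leb2.
Proof.
have /sigma_finiteP[F [TF ndF Foo]] := sigma_finiteT (@lebesgue_measure R).
exists (fun n => F n `*` F n).
  rewrite -setXTT TF predeqE => -[x y]; split.
    move=> [[i _ Fx] [j _ Fy]]; exists (maxn i j) => //; split => /=.
      by move/subsetPset : (ndF _ _ (leq_maxl i j)); exact.
    by move/subsetPset : (ndF _ _ (leq_maxr i j)); exact.
  by move=> [n _ [? ?]]; split; exists n.
move=> n; have [mF Fn] := Foo n; split; first exact: measurableX.
by rewrite /leb2 product_measure1E// lte_mul_pinfty// ge0_fin_numE.
Qed.

HB.instance Definition _ :=
  Measure_isSigmaFinite.Build _ _ _ leb2 leb2_sigma_finite.

End leb2.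

(** * Tonelli, translation invariance and measurability on R^3 *)

Section R3_measure.
Context {R : realType}.
Notation V := (R3 R).
Notation leb := (@lebesgue_measure R).

(** The image of Lebesgue measure under a translation agrees with it on the intervals []u, v]],
    which determine it. *)
Lemma ge0_integral_leb_shift (f : measurableTypeR R -> \bar R) (a : R) :
  measurable_fun setT f -> (forall x, (0 <= f x)%E) ->
  (\int[leb]_x f (x + a)%R = \int[leb]_x f x)%E.
Proof.
move=> mf f0.
have ma : measurable_fun setT (fun x : measurableTypeR R => x + a : measurableTypeR R).
  by apply: measurable_funD => //; exact: measurable_cst.
rewrite -[LHS](@ge0_integral_pushforward _ _ _ _ R
  (fun x : measurableTypeR R => x + a : measurableTypeR R)
  ma leb setT f)//.
apply: eq_measure_integral => A mA _.
apply/esym/lebesgue_measure_unique => //= _ [[u v]] _ <-.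
rewrite /pushforward.
rewrite (_ : (fun x => x + a) @^-1` `]u, v] = `]u - a, v - a]%classic); last first.
  by apply/seteqP; split => x /=; rewrite !in_itv/= ltrBlDr lerBrDr.
rewrite !lebesgue_measure_itv/= !lte_fin ltrD2r -!EFinB.
by rewrite (_ : v - a - (u - a) = v - u)//; ring.
Qed.

Lemma ge0_integral_volE (f : V -> \bar R) :
  measurable_fun setT f -> (forall x, (0 <= f x)%E) ->
  (\int[vol]_x f x =
   \int[leb]_x1 \int[leb]_x2 \int[leb]_x3 f (x1, x2, x3))%E.
Proof.
move=> mf f0.
rewrite [LHS](fubini_tonelli1 (m1 := leb2) (m2 := leb))//.
rewrite (fubini_tonelli1 (m1 := leb) (m2 := leb))//.
  exact: measurable_fun_fubini_tonelli_F.
by move=> x; exact: integral_ge0.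
Qed.

Lemma measurable_R3_pair d (T : measurableType d) (f g h : T -> R) :
  measurable_fun setT f -> measurable_fun setT g -> measurable_fun setT h ->
  measurable_fun setT (fun x => (f x, g x, h x) : V).
Proof. by move=> mf mg mh; do 2 apply: measurable_fun_pair => //. Qed.

Lemma measurable_R3_1 : measurable_fun setT (fun x : V => x.1.1 : R).
Proof. exact: (measurableT_comp measurable_fst measurable_fst). Qed.

Lemma measurable_R3_2 : measurable_fun setT (fun x : V => x.1.2 : R).
Proof. exact: (measurableT_comp measurable_snd measurable_fst). Qed.

Lemma measurable_R3_3 : measurable_fun setT (fun x : V => x.2 : R).
Proof. exact: measurable_snd. Qed.

Lemma measurable_funD_R3 d (T : measurableType d) (f g : T -> V) :
  measurable_fun setT f -> measurable_fun setT g ->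
  measurable_fun setT (fun x => f x + g x : V).
Proof.
move=> mf mg; apply: measurable_R3_pair; apply: measurable_funD.
- exact: (measurableT_comp measurable_R3_1 mf).
- exact: (measurableT_comp measurable_R3_1 mg).
- exact: (measurableT_comp measurable_R3_2 mf).
- exact: (measurableT_comp measurable_R3_2 mg).
- exact: (measurableT_comp measurable_R3_3 mf).
- exact: (measurableT_comp measurable_R3_3 mg).
Qed.

Lemma measurable_funN_R3 d (T : measurableType d) (f : T -> V) :
  measurable_fun setT f -> measurable_fun setT (fun x => - f x : V).
Proof.
move=> mf; apply: measurable_R3_pair; apply: measurable_funN.
- exact: (measurableT_comp measurable_R3_1 mf).
- exact: (measurableT_comp measurable_R3_2 mf).
- exact: (measurableT_comp measurable_R3_3 mf).
Qed.

Lemma measurable_fun_dot3 d (T : measurableType d) (f g : T -> V) :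
  measurable_fun setT f -> measurable_fun setT g ->
  measurable_fun setT (fun x => dot3 (f x) (g x)).
Proof.
move=> mf mg; rewrite /dot3; apply: measurable_funD; first apply: measurable_funD;
  apply: measurable_funM.
- exact: (measurableT_comp measurable_R3_1 mf).
- exact: (measurableT_comp measurable_R3_1 mg).
- exact: (measurableT_comp measurable_R3_2 mf).
- exact: (measurableT_comp measurable_R3_2 mg).
- exact: (measurableT_comp measurable_R3_3 mf).
- exact: (measurableT_comp measurable_R3_3 mg).
Qed.

Lemma measurable_fun_sqrt d (T : measurableType d) (f : T -> R) :
  measurable_fun setT f -> measurable_fun setT (fun x => Num.sqrt (f x)).
Proof.
move=> mf; apply: (measurableT_comp (f := @Num.sqrt R)) mf.
by apply: continuous_measurable_fun; exact: sqrt_continuous.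
Qed.

Lemma measurable_funV_gt0 d (T : measurableType d) (f : T -> R) :
  (forall x, 0 < f x) ->
  measurable_fun setT f -> measurable_fun setT (fun x => (f x)^-1).
Proof.
move=> f0 mf.
rewrite (_ : (fun _ => _) = (fun x => (f x) `^ (-1))); last first.
  by apply/funext => x; rewrite powR_inv1// ltW.
apply: (measurableT_comp (f := fun y => y `^ (-1))) mf; exact: measurable_powR.
Qed.

Lemma measurable_fun_norm3 d (T : measurableType d) (f : T -> V) :
  measurable_fun setT f -> measurable_fun setT (fun x => norm3 (f x)).
Proof. by move=> mf; apply: measurable_fun_sqrt; exact: measurable_fun_dot3. Qed.

Lemma measurable_open_ball (b : V) (r : R) : measurable (open_ball b r).
Proof.
have -> : open_ball b r = (fun x => norm3 (x - b)) @^-1` `]-oo, r[.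
  by apply/seteqP; split => x /=; rewrite in_itv.
rewrite -[X in measurable X]setTI.
have h : measurable_fun setT (fun x : V => norm3 (x - b)).
  apply: measurable_fun_norm3.
  by apply: measurable_funD_R3 => //; exact: measurable_cst.
by apply: h.
Qed.

Lemma ge0_integral_vol_shift (f : V -> \bar R) (h : V) :
  measurable_fun setT f -> (forall x, (0 <= f x)%E) ->
  (\int[vol]_x f (x + h)%R = \int[vol]_x f x)%E.
Proof.
move=> mf f0.
have mh : measurable_fun setT (fun x : V => x + h).
  by apply: measurable_funD_R3 => //; exact: measurable_cst.
have mfh : measurable_fun setT (fun x : V => f (x + h)%R).
  exact: (measurableT_comp mf mh).
rewrite (ge0_integral_volE mf f0) (ge0_integral_volE mfh (fun x => f0 _)).
have m3 x1 x2 : measurable_fun setT (fun x3 => f (x1, x2, x3)).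
  apply: (measurableT_comp mf).
  by apply: measurable_R3_pair => //; exact: measurable_cst.
have m2 x1 : measurable_fun setT (fun x2 => \int[leb]_x3 f (x1, x2, x3))%E.
  apply: (measurable_fun_fubini_tonelli_F (fun x23 :
    measurableTypeR R * measurableTypeR R => f (x1, x23.1, x23.2))) => //.
  apply: (measurableT_comp mf).
  by apply: measurable_R3_pair => //; exact: measurable_cst.
have m1 : measurable_fun setT (fun x1 => \int[leb]_x2 \int[leb]_x3 f (x1, x2, x3))%E.
  apply: (measurable_fun_fubini_tonelli_F (fun x12 :
    measurableTypeR R * measurableTypeR R =>
    \int[leb]_x3 f (x12.1, x12.2, x3))%E) => //.
    apply: (measurable_fun_fubini_tonelli_F (fun x : V => f (x.1.1, x.1.2, x.2)))=> //.
    by rewrite (_ : (fun _ => _) = f)//; apply/funext => -[[]].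
  by move=> x; exact: integral_ge0.
rewrite -[RHS](ge0_integral_leb_shift h.1.1 m1); last first.
  by move=> x; apply: integral_ge0 => ? _; exact: integral_ge0.
apply: eq_integral => x1 _.
rewrite -[RHS](ge0_integral_leb_shift h.1.2 (m2 _)); last first.
  by move=> x; exact: integral_ge0.
apply: eq_integral => x2 _.
by rewrite -[RHS](ge0_integral_leb_shift h.2 (m3 _ _)).
Qed.

End R3_measure.

(** * The exponential weight and its Fourier transform *)

Section exponential_weight.
Context {R : realType}.
Notation V := (R3 R).
Notation leb := (@lebesgue_measure R).
Implicit Types (a c al be : R).

(** The offset [al >= be] keeps the oscillating integrand nonnegative, as the fundamental theorem on
    a half-line and Tonelli require. *)
Let damped al be a c (x : R) := expR (- x) * (al + be * cos (a * x + c)).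

Let primitive al be a c (x : R) := expR (- x) *
  (be / (1 + a ^+ 2) * (a * sin (a * x + c) - cos (a * x + c)) - al).

Let is_derive_primitive al be a c (x : R) :
  is_derive x 1 (primitive al be a c) (damped al be a c x).
Proof.
have a0 : 1 + a ^+ 2 != 0 by rewrite gt_eqF// ltr_pwDl// sqr_ge0.
rewrite /primitive /damped; apply: is_derive_eq.
by rewrite /GRing.scale/=; field.
Qed.

Let continuous_damped al be a c : continuous (damped al be a c).
Proof.
move=> x; apply/differentiable_continuous/derivable1_diffP.
by rewrite /damped; apply: ex_derive.
Qed.

Let cvg_primitive al be a c : primitive al be a c x @[x --> +oo] --> (0 : R).
Proof.
pose C := `|be / (1 + a ^+ 2)| * (`|a| + 1) + `|al|.
have bnd x : `|primitive al be a c x| <= C * expR (- x).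
  rewrite normrM (ger0_norm (expR_ge0 _)) mulrC ler_wpM2r ?expR_ge0//.
  rewrite (le_trans (ler_normB _ _))// lerD2r normrM ler_wpM2l//.
  rewrite (le_trans (ler_normB _ _))// lerD//.
    rewrite normrM ler_piMr// ler_norml sin_geN1 sin_le1//.
  by rewrite ler_norml cos_geN1 cos_le1.
have e0 : C * expR (- x) @[x --> +oo] --> (0 : R).
  rewrite -[X in _ --> X](mulr0 C); apply: cvgM; first exact: cvg_cst.
  exact: cvgr_expR.
apply: (@squeeze_cvgr _ _ _ _ (fun x => - (C * expR (- x))) (fun x => C * expR (- x))).
- by near=> x; rewrite -ler_norml.
- by rewrite -[X in _ --> X]oppr0; apply: cvgN.
- exact: e0.
Unshelve. all: by end_near. Qed.

Let integral0y_damped al be a c : 0 <= be <= al ->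
  (\int[leb]_(x in `[0%R, +oo[) (damped al be a c x)%:E =
   (al + be / (1 + a ^+ 2) * (cos c - a * sin c))%:E)%E.
Proof.
move=> /andP[be0 beal].
rewrite (@ge0_continuous_FTC2y _ (damped al be a c) (primitive al be a c) 0 0).
- rewrite sub0e -EFinN /primitive oppr0 expR0 mulr0 add0r mul1r.
  by congr EFin; ring.
- move=> x _; rewrite mulr_ge0 ?expR_ge0// -lerBlDl sub0r.
  rewrite (le_trans _ (ler_wpM2l be0 (cos_geN1 _)))// mulrN1 lerN2//.
- exact/continuous_subspaceT/continuous_damped.
- exact: cvg_primitive.
- by move=> x _; apply: ex_derive; exact: is_derive_primitive.
- apply: cvg_at_right_filter.
  apply/differentiable_continuous/derivable1_diffP.
  by apply: ex_derive; exact: is_derive_primitive.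
- by move=> x _; rewrite derive1E; have [_ ->] := is_derive_primitive al be a c x.
Qed.

(** Reflecting the negative half-line replaces [a] by [- a], so the sine terms of the two halves
    cancel. The phase [c] is kept because, in an iterated integral, it carries the contribution of
    the other coordinates. *)
Lemma integral_expNnorm_cos al be a c : 0 <= be <= al ->
  (\int[leb]_x (expR (- `|x|) * (al + be * cos (a * x + c)))%:E =
   (2 * al + be * (2 / (1 + a ^+ 2)) * cos c)%:E)%E.
Proof.
move=> beal.
pose g (x : R) := expR (- `|x|) * (al + be * cos (a * x + c)).
have g0 x : 0 <= g x.
  case/andP : beal => be0 beal.
  rewrite /g mulr_ge0 ?expR_ge0// -lerBlDl sub0r.
  by rewrite (le_trans _ (ler_wpM2l be0 (cos_geN1 _)))// mulrN1 lerN2.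
have ccos : continuous (fun x : R => al + be * cos (a * x + c)).
  move=> x; apply/differentiable_continuous/derivable1_diffP.
  by apply: ex_derive.
have cg : continuous g.
  move=> x; apply: cvgM.
    apply: (@cvg_comp _ _ _ (fun y : R => - `|y|) expR _ (nbhs (- `|x|))).
      by apply: cvgN; apply: cvg_norm; exact: cvg_id.
    exact: continuous_expR.
  exact: ccos.
have mg : measurable_fun setT (EFin \o g : measurableTypeR R -> \bar R).
  by apply/measurable_EFinP; exact: continuous_measurable_fun.
have posE : (\int[leb]_(x in `[0%R, +oo[) (g x)%:E =
   (al + be / (1 + a ^+ 2) * (cos c - a * sin c))%:E)%E.
  rewrite -integral0y_damped//; apply: eq_integral => x.
  by rewrite inE/= in_itv/= andbT => x0; rewrite /g ger0_norm.
have negE : (\int[leb]_(x in `]-oo, 0%R]) (g x)%:E =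
   (al + be / (1 + a ^+ 2) * (cos c + a * sin c))%:E)%E.
  transitivity (\int[leb]_(x in `]-oo, 0%R]) (g (- - x))%:E)%E.
    by apply: eq_integral => x _; rewrite opprK.
  rewrite -(@ge0_integration_by_substitution0 R (fun x => (g (- x))%:E)); last 2 first.
  - apply/measurable_EFinP; apply: (measurableT_comp (f := g)) => //.
    exact/measurable_EFinP.
  - by move=> x; rewrite lee_fin.
  transitivity (\int[leb]_(x in `[0%R, +oo[) (damped al be (- a) c x)%:E)%E.
    apply: eq_integral => x.
    rewrite inE/= in_itv/= andbT => x0.
    by rewrite /g /damped normrN ger0_norm// mulrN mulNr.
  by rewrite integral0y_damped// sqrrN; congr EFin; ring.
rewrite -[LHS]/(\int[leb]_x (g x)%:E)%E.
have a0 : 1 + a ^+ 2 != 0 by rewrite gt_eqF// ltr_pwDl// sqr_ge0.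
rewrite -(setUv `]-oo, 0%R]) ge0_integral_setU//=; first last.
- by rewrite disj_set2E setICr.
- by move=> x _; rewrite lee_fin.
- exact: measurable_funTS.
- exact: measurableC.
rewrite setCitvl negE integral_itv_obnd_cbnd; last first.
  by apply/measurable_EFinP/measurable_funTS; exact/measurable_EFinP.
by rewrite posE -EFinD; congr EFin; field.
Qed.

Lemma integral_cauchy :
  (\int[leb]_x (2 / (1 + x ^+ 2))%:E = (2 * pi)%:E)%E.
Proof.
have gt0 (x : R) : 0 < 1 + x ^+ 2 by rewrite ltr_pwDl// sqr_ge0.
have c0 : continuous (fun x : R => 2 / (1 + x ^+ 2)).
  move=> x; apply: cvgM; first exact: cvg_cst.
  exact: (@continuous_oneDsqrV R x).
rewrite ge0_symfun_integralT//=; last first.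
- by move=> x; rewrite /= sqrrN.
- by move=> x; rewrite divr_ge0// ltW.
rewrite (_ : [set x | _] = `[0, +oo[%classic); last first.
  by apply/seteqP; split => x/=; rewrite in_itv/= andbT.
under eq_integral do rewrite EFinM.
rewrite ge0_integralZl_EFin//.
- rewrite integral0y_oneDsqr -!EFinM; congr EFin.
  by field.
- by move=> x _; rewrite lee_fin invr_ge0 ltW.
- have mV : measurable_fun setT (fun x : measurableTypeR R => (1 + x ^+ 2)^-1).
    apply: measurable_funV_gt0 => //; apply: measurable_funD.
      exact: measurable_cst.
    exact: measurable_funX.
  exact/measurable_EFinP/measurable_funTS.
Qed.

Definition expw (x : V) : R :=
  expR (- `|x.1.1|) * expR (- `|x.1.2|) * expR (- `|x.2|).

Definition cauchyw (h : V) : R :=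
  2 / (1 + h.1.1 ^+ 2) * (2 / (1 + h.1.2 ^+ 2)) * (2 / (1 + h.2 ^+ 2)).

Let cauchy01 (x : R) : 0 <= 2 / (1 + x ^+ 2) <= 2.
Proof.
have x0 : 0 < 1 + x ^+ 2 by rewrite ltr_pwDl// sqr_ge0.
rewrite divr_ge0 ?(ltW x0)//= ler_pdivrMr// ler_peMr// lerDl sqr_ge0//.
Qed.

Let measurable_fun_cauchy d (T : measurableType d) (f : T -> R) :
  measurable_fun setT f -> measurable_fun setT (fun x => 2 / (1 + f x ^+ 2)).
Proof.
move=> mf; apply: measurable_funM; first exact: measurable_cst.
apply: measurable_funV_gt0; first by move=> x; rewrite ltr_pwDl// sqr_ge0.
apply: measurable_funD; first exact: measurable_cst.
exact: measurable_funX.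
Qed.

Let measurable_fun_expN d (T : measurableType d) (f : T -> R) :
  measurable_fun setT f -> measurable_fun setT (fun x => expR (- `|f x|)).
Proof.
move=> mf; apply: (measurableT_comp (@measurable_expR R)).
apply: measurable_funN; exact: (measurableT_comp (@normr_measurable R setT)).
Qed.

Lemma measurable_expw : measurable_fun setT expw.
Proof.
apply: measurable_funM; first apply: measurable_funM; apply: measurable_fun_expN.
- exact: measurable_R3_1.
- exact: measurable_R3_2.
- exact: measurable_R3_3.
Qed.

Lemma measurable_cauchyw : measurable_fun setT cauchyw.
Proof.
apply: measurable_funM; first apply: measurable_funM; apply: measurable_fun_cauchy.
- exact: measurable_R3_1.
- exact: measurable_R3_2.
- exact: measurable_R3_3.
Qed.

Lemma expw_ge0 x : 0 <= expw x.
Proof. by rewrite /expw !mulr_ge0 ?expR_ge0. Qed.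

Lemma cauchyw_ge0 h : 0 <= cauchyw h.
Proof.
have /andP[x0 _] := cauchy01 h.1.1; have /andP[y0 _] := cauchy01 h.1.2.
have /andP[z0 _] := cauchy01 h.2; by do 2 (apply: mulr_ge0 => //).
Qed.

Lemma measurable_cos_dot3 d (T : measurableType d) (f g : T -> V) :
  measurable_fun setT f -> measurable_fun setT g ->
  measurable_fun setT (fun x => cos (dot3 (f x) (g x))).
Proof.
move=> mf mg; apply: (measurableT_comp (f := @cos R)).
  by apply: continuous_measurable_fun; exact: continuous_cos.
exact: measurable_fun_dot3.
Qed.

(** One coordinate is integrated at a time, the innermost first, with the outer coordinates in the
    phase. Each step doubles the offset and multiplies the amplitude by a Cauchy factor at most 2,
    so the amplitude stays below the offset. *)
Lemma integral_expw_cos al be (q : V) : 0 <= be <= al ->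
  (\int[vol]_x (expw x * (al + be * cos (dot3 q x)))%:E =
   (8 * al + be * cauchyw q)%:E)%E.
Proof.
move=> /andP[be0 beal].
rewrite ge0_integral_volE; first last.
- move=> x; rewrite lee_fin mulr_ge0 ?expw_ge0// -lerBlDl sub0r.
  by rewrite (le_trans _ (ler_wpM2l be0 (cos_geN1 _)))// mulrN1 lerN2.
- apply/measurable_EFinP/measurable_funM; first exact: measurable_expw.
  apply: measurable_funD; first exact: measurable_cst.
  apply: measurable_funM; first exact: measurable_cst.
  by apply: measurable_cos_dot3; first exact: measurable_cst.
pose e (x : R) := expR (- `|x|).
have e0 x : 0 <= e x by exact: expR_ge0.
pose k (x : R) := 2 / (1 + x ^+ 2).
have k0 x : 0 <= k x by have /andP[] := cauchy01 x.
have k2 x : k x <= 2 by have /andP[] := cauchy01 x.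
transitivity (\int[leb]_x1 \int[leb]_x2
  (e x2 * (e x1 * (2 * al) + e x1 * (be * k q.2) * cos (q.1.2 * x2 + q.1.1 * x1)))%:E)%E.
  apply: eq_integral => x1 _; apply: eq_integral => x2 _.
  transitivity (\int[leb]_x3
    (e x3 * (e x1 * e x2 * al +
      e x1 * e x2 * be * cos (q.2 * x3 + (q.1.1 * x1 + q.1.2 * x2))))%:E)%E.
    apply: eq_integral => x3 _; congr EFin.
    by rewrite /expw /dot3/= /e (addrC (q.2 * x3)); ring.
  rewrite integral_expNnorm_cos; last first.
    by rewrite !mulr_ge0//= ler_wpM2l// mulr_ge0.
  by congr EFin; rewrite /k (addrC (q.1.1 * x1)); ring.
transitivity (\int[leb]_x1
  (e x1 * (4 * al + be * k q.2 * k q.1.2 * cos (q.1.1 * x1 + 0)))%:E)%E.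
  apply: eq_integral => x1 _.
  rewrite integral_expNnorm_cos; last first.
    apply/andP; split; first by do 2 (apply: mulr_ge0 => //).
    by rewrite ler_wpM2l// mulrC ler_pM.
  by congr EFin; rewrite /k addr0; ring.
rewrite integral_expNnorm_cos; last first.
  apply/andP; split; first by do 2 (apply: mulr_ge0 => //).
  rewrite (_ : 4 * al = al * 2 * 2); last by ring.
  by rewrite !ler_pM// mulr_ge0.
by congr EFin; rewrite cos0 /cauchyw /k; ring.
Qed.

Lemma integral_expw : (\int[vol]_x (expw x)%:E = 8%:E :> \bar R)%E.
Proof.
have := @integral_expw_cos 1 0 0; rewrite lexx ler01 => /(_ isT).
by under eq_integral do rewrite mul0r addr0 mulr1; rewrite mul0r addr0 mulr1.
Qed.

Lemma integral_vol_prod (f1 f2 f3 : measurableTypeR R -> R) (a1 a2 a3 : R) :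
  (forall x, 0 <= f1 x) -> (forall x, 0 <= f2 x) -> (forall x, 0 <= f3 x) ->
  measurable_fun setT f1 -> measurable_fun setT f2 -> measurable_fun setT f3 ->
  (\int[leb]_x (f1 x)%:E = a1%:E)%E -> (\int[leb]_x (f2 x)%:E = a2%:E)%E ->
  (\int[leb]_x (f3 x)%:E = a3%:E)%E ->
  (\int[vol]_x (f1 x.1.1 * f2 x.1.2 * f3 x.2)%:E = (a1 * a2 * a3)%:E)%E.
Proof.
move=> f10 f20 f30 mf1 mf2 mf3 if1 if2 if3.
rewrite ge0_integral_volE; first last.
- by move=> x; rewrite lee_fin !mulr_ge0.
- apply/measurable_EFinP; apply: measurable_funM; first apply: measurable_funM.
  + exact: (measurableT_comp mf1 measurable_R3_1).
  + exact: (measurableT_comp mf2 measurable_R3_2).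
  + exact: (measurableT_comp mf3 measurable_R3_3).
have pull (f : measurableTypeR R -> R) (a k : R) : (forall x, 0 <= f x) -> 0 <= k ->
    measurable_fun setT f -> (\int[leb]_x (f x)%:E = a%:E)%E ->
    (\int[leb]_x (k * f x)%:E = (k * a)%:E)%E.
  move=> f0 k0 mf fa; under eq_integral do rewrite EFinM.
  rewrite ge0_integralZl_EFin ?fa//.
    by move=> x _; rewrite lee_fin.
  exact/measurable_EFinP.
have a20 : 0 <= a2 by rewrite -lee_fin -if2 integral_ge0// => x _; rewrite lee_fin.
have a30 : 0 <= a3 by rewrite -lee_fin -if3 integral_ge0// => x _; rewrite lee_fin.
transitivity (\int[leb]_x1 \int[leb]_x2 (f1 x1 * a3 * f2 x2)%:E)%E.
  apply: eq_integral => x1 _; apply: eq_integral => x2 _.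
  by rewrite /= (pull f3 a3)// ?mulr_ge0//; congr EFin; ring.
transitivity (\int[leb]_x1 (a2 * a3 * f1 x1)%:E)%E.
  apply: eq_integral => x1 _.
  by rewrite (pull f2 a2)// ?mulr_ge0//; congr EFin; ring.
by rewrite (pull f1 a1)// ?mulr_ge0//; congr EFin; ring.
Qed.

Lemma integral_cauchyw : (\int[vol]_x (cauchyw x)%:E = ((2 * pi) ^+ 3)%:E)%E.
Proof.
have k0 x : 0 <= 2 / (1 + x ^+ 2) :> R by have /andP[] := cauchy01 x.
have mk : measurable_fun setT (fun x : measurableTypeR R => 2 / (1 + x ^+ 2)).
  exact: measurable_fun_cauchy.
rewrite /cauchyw (integral_vol_prod k0 k0 k0 mk mk mk integral_cauchy integral_cauchy
  integral_cauchy).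
by congr EFin; ring.
Qed.

End exponential_weight.

(** * The properties of the kernels on which the localization rests *)

Section kernels.
Context {R : realType}.
Notation V := (R3 R).

(* The features [w] play the role of the dilation of the POL to a projection
   valued measure. *)
Record slowly_varying_kernel (t : V -> V -> R) : Prop := {
  svk_feature : exists n (w : 'I_n -> V -> R),
    (forall i, measurable_fun setT (w i)) /\
    (forall k p, t k p = \sum_i w i k * w i p);
  svk_diag : forall k, t k k = 1;
  svk_ge0 : forall k p, 0 <= t k p;
  svk_lower : forall k0, exists2 d, 0 < d & forall p, d <= t k0 p;
  svk_decay : exists2 C, 0 <= C &
    forall k p, (1 - t k p) * norm3 k <= C * norm3 (p - k) ^+ 2
}.

Lemma dot3_ge0 (p : V) : 0 <= dot3 p p.
Proof. by rewrite /dot3 -!expr2 !addr_ge0 ?sqr_ge0. Qed.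

Lemma norm3_ge0 (p : V) : 0 <= norm3 p.
Proof. exact: sqrtr_ge0. Qed.

Lemma norm3_sqr (p : V) : norm3 p ^+ 2 = dot3 p p.
Proof. by rewrite sqr_sqrtr// dot3_ge0. Qed.

Lemma norm3B_sqr (p q : V) :
  norm3 (p - q) ^+ 2 = norm3 p ^+ 2 + norm3 q ^+ 2 - 2 * dot3 q p.
Proof. by rewrite !norm3_sqr /dot3/=; ring. Qed.

(** One half of Cauchy-Schwarz, by Lagrange's identity: the defect of the squares is the squared
    length of the cross product. *)
Lemma dot3_geN (p q : V) : - (norm3 p * norm3 q) <= dot3 p q.
Proof.
rewrite lerNl; apply: (le_trans (ler_norm _)); rewrite normrN.
rewrite -(ler_sqr (_ : _ \is Num.nneg)) ?nnegrE ?mulr_ge0 ?norm3_ge0//.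
rewrite real_normK ?num_real// exprMn !norm3_sqr -subr_ge0 /dot3.
case: p q => [[a b] c] [[a' b'] c'] /=.
rewrite [leRHS](_ : _ = (a * b' - b * a') ^+ 2 + (a * c' - c * a') ^+ 2 +
  (b * c' - c * b') ^+ 2); last by ring.
by rewrite !addr_ge0 ?sqr_ge0.
Qed.

Section feature.
Variables (t : V -> V -> R) (vt : slowly_varying_kernel t).

Lemma measurable_fun_svk d (T : measurableType d) (f g : T -> V) :
  measurable_fun setT f -> measurable_fun setT g ->
  measurable_fun setT (fun x => t (f x) (g x)).
Proof.
move=> mf mg; have [n [w [mw tE]]] := svk_feature vt.
rewrite (_ : (fun _ => _) = (fun x => \sum_i w i (f x) * w i (g x))); last first.
  by apply/funext => x; rewrite tE.
apply: measurable_sum => i; apply: measurable_funM.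
  exact: (measurableT_comp (mw i) mf).
exact: (measurableT_comp (mw i) mg).
Qed.

(* Bessel's inequality for the unit vector [w k0]. *)
Lemma svk_lipschitz k0 k p : (t k0 k - t k0 p) ^+ 2 <= 2 * (1 - t k p).
Proof.
have [n [w [_ tE]]] := svk_feature vt.
pose s := t k0 k - t k0 p.
have : 0 <= \sum_i (w i k - w i p - s * w i k0) ^+ 2.
  by apply: sumr_ge0 => i _; exact: sqr_ge0.
have -> : \sum_i (w i k - w i p - s * w i k0) ^+ 2 =
    t k k + t p p - 2 * t k p - 2 * s * (t k0 k - t k0 p) + s ^+ 2 * t k0 k0.
  transitivity (\sum_i (w i k * w i k + w i p * w i p - 2 * (w i k * w i p)
    - 2 * s * (w i k0 * w i k - w i k0 * w i p) + s ^+ 2 * (w i k0 * w i k0))).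
    by apply: eq_bigr => i _; ring.
  by rewrite !big_split/= !sumrN -!mulr_sumr sumrB -!tE.
rewrite -/s !(svk_diag vt); lra.
Qed.

Lemma svk_le1 k p : t k p <= 1.
Proof.
by have := le_trans (sqr_ge0 _) (svk_lipschitz k k p); lra.
Qed.

End feature.

Variable m : R.
Hypothesis m0 : 0 < m.
Local Notation e := (energy m).

Lemma energy_sqr (p : V) : e p ^+ 2 = m ^+ 2 + norm3 p ^+ 2.
Proof. by rewrite sqr_sqrtr// addr_ge0 ?sqr_ge0. Qed.

Lemma energy_gem (p : V) : m <= e p.
Proof.
rewrite -ler_sqr ?nnegrE ?sqrtr_ge0 ?(ltW m0)//.
by rewrite energy_sqr lerDl sqr_ge0.
Qed.

Lemma energy_gt0 (p : V) : 0 < e p.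
Proof. exact: lt_le_trans (energy_gem p). Qed.

Lemma norm3_lt_energy (p : V) : norm3 p < e p.
Proof.
rewrite -ltr_sqr ?nnegrE ?sqrtr_ge0//.
by rewrite energy_sqr ltrDr exprn_gt0.
Qed.

(** The two sides differ by exactly half of [(e k - e p) ^+ 2]. *)
Lemma energyM_le (k p : V) :
  e k * e p - m ^+ 2 - dot3 k p <= 2^-1 * norm3 (p - k) ^+ 2.
Proof.
have := sqr_ge0 (e k - e p).
have := energy_sqr k; have := energy_sqr p; have := norm3B_sqr p k.
move: (norm3 (p - k)) (norm3 k) (norm3 p) (e k) (e p) (dot3 k p) => *; nra.
Qed.

Lemma measurable_energy : measurable_fun setT e.
Proof.
apply: measurable_fun_sqrt; apply: measurable_funD; first exact: measurable_cst.
by apply: measurable_funX; exact: measurable_fun_norm3.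
Qed.

(** Of the two energies in the denominator, [e k] absorbs [norm3 k] and [e p] is bounded below by
    [m]; this is the origin of the constant [(4 * m)^-1]. *)
Lemma decay_estimate (k p : V) (x : R) :
  x <= 4^-1 * norm3 (p - k) ^+ 2 / (e k * e p) ->
  x * norm3 k <= (4 * m)^-1 * norm3 (p - k) ^+ 2.
Proof.
move=> xle; have ek := energy_gt0 k; have ep := energy_gt0 p.
apply: (le_trans (ler_wpM2r (norm3_ge0 k) xle)).
set A := norm3 (p - k) ^+ 2.
rewrite [leLHS](_ : _ = 4^-1 * A * (norm3 k / e k * (e p)^-1)); last first.
  by field; rewrite !gt_eqF.
rewrite [leRHS](_ : _ = 4^-1 * A * (1 * m^-1)); last by field; rewrite gt_eqF.
apply: ler_wpM2l; first by rewrite mulr_ge0// sqr_ge0.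
rewrite ler_pM ?divr_ge0 ?invr_ge0 ?norm3_ge0 ?(ltW ek) ?(ltW ep)//.
  by rewrite ler_pdivrMr// mul1r ltW// norm3_lt_energy.
by rewrite lef_pV2 ?posrE// energy_gem.
Qed.

Lemma slowly_varying_tTM : slowly_varying_kernel (tTM m).
Proof.
have s2 : Num.sqrt 2^-1 * Num.sqrt 2^-1 = 2^-1 :> R.
  by rewrite -expr2 sqr_sqrtr.
have en0 p : e p != 0 by rewrite gt_eqF// energy_gt0.
split.
- pose s : R := Num.sqrt 2^-1.
  (* The feature vector is (1, m/e, p/e)/sqrt 2, of unit length because e^2 = m^2 + |p|^2. *)
  exists 5%N, (fun i p => [:: s; s * (m / e p); s * (p.1.1 / e p);
    s * (p.1.2 / e p); s * (p.2 / e p)]`_i); split; last first.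
    move=> k p; rewrite !big_ord_recl big_ord0/= /tTM /dot3 -s2 -/s.
    by field; rewrite !en0.
  have mi : measurable_fun setT (fun p : V => (e p)^-1).
    by apply: measurable_funV_gt0 measurable_energy; exact: energy_gt0.
  have mc : measurable_fun setT (cst s : V -> R) by exact: measurable_cst.
  case=> -[|[|[|[|[|//]]]]] ? /=; first exact: mc; apply: measurable_funM => //;
    apply: measurable_funM => //.
  + exact: measurable_R3_1.
  + exact: measurable_R3_2.
- move=> k; rewrite /tTM.
  have -> : (m ^+ 2 + dot3 k k) / (e k * e k) = 1.
    by rewrite -norm3_sqr -energy_sqr -expr2 divff// expf_neq0.
  lra.
- move=> k p; rewrite /tTM mulr_ge0//.
  have ekp : 0 < e k * e p by rewrite mulr_gt0 ?energy_gt0.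
  rewrite -(divff (lt0r_neq0 ekp)) -mulrDl divr_ge0 ?(ltW ekp)//.
  have := dot3_geN k p.
  have := ler_pM (norm3_ge0 k) (norm3_ge0 p) (ltW (norm3_lt_energy k)) (ltW (norm3_lt_energy p)).
  by have := sqr_ge0 m; lra.
(* By Cauchy-Schwarz the numerator [m ^+ 2 + dot3 k0 p] is at least [- norm3 k0 * e p], so [e p]
   cancels and the bound no longer depends on [p]. It is positive because [m > 0]. *)
- move=> k0; exists (2^-1 * (1 - norm3 k0 / e k0)).
    by rewrite mulr_gt0// subr_gt0 ltr_pdivrMr ?energy_gt0// mul1r norm3_lt_energy.
  move=> p; rewrite /tTM ler_pM2l// lerD2l -mulNr.
  rewrite ler_pdivlMr ?mulr_gt0 ?energy_gt0//.
  rewrite [leLHS](_ : _ = - (norm3 k0 * e p)); last by field; rewrite !en0.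
  have := dot3_geN k0 p.
  have := ler_wpM2l (norm3_ge0 k0) (ltW (norm3_lt_energy p)).
  by have := sqr_ge0 m; lra.
- exists (4 * m)^-1; first by rewrite invr_ge0 mulr_ge0// ltW.
  move=> k p; apply: decay_estimate.
  rewrite [leLHS](_ : _ = 2^-1 * (e k * e p - m ^+ 2 - dot3 k p) / (e k * e p)).
    rewrite ler_pM2r ?invr_gt0 ?mulr_gt0 ?energy_gt0//.
    by have := energyM_le k p; lra.
  by rewrite /tTM; field; rewrite !en0.
Qed.

Lemma slowly_varying_ttct : slowly_varying_kernel (ttct m).
Proof.
have s2 : Num.sqrt 2^-1 * Num.sqrt 2^-1 = 2^-1 :> R.
  by rewrite -expr2 sqr_sqrtr.
pose X p := e p * (m + e p).
have me p : 0 < m + e p by rewrite addr_gt0 ?energy_gt0.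
have X0 p : 0 < X p by rewrite mulr_gt0 ?energy_gt0.
have sX0 p : 0 < Num.sqrt (X p) by rewrite sqrtr_gt0.
have sXn0 p : Num.sqrt (X p) != 0 by rewrite gt_eqF.
have tE k p : ttct m k p = 2^-1 / (Num.sqrt (X k) * Num.sqrt (X p)) *
    ((m + e k) * (m + e p) + dot3 k p).
  by rewrite /ttct -[energy m k * _]/(X k) -[energy m p * _]/(X p) sqrtrM// ltW.
split.
- pose s : R := Num.sqrt 2^-1.
  pose c p := s / Num.sqrt (X p).
  (* The feature vector is (m + e, p)/sqrt(2 e (m + e)), of unit length because |p|^2 = (e - m)(e +
     m). *)
  exists 4%N, (fun i p => [:: c p * (m + e p); c p * p.1.1; c p * p.1.2;
    c p * p.2]`_i); split; last first.
    move=> k p; rewrite !big_ord_recl big_ord0/= tE /dot3 -s2 -/s /c.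
    by field; rewrite !sXn0.
  have mme : measurable_fun setT (fun p : V => m + e p).
    apply: measurable_funD; [exact: measurable_cst|exact: measurable_energy].
  have mc : measurable_fun setT c.
    apply: measurable_funM; first exact: measurable_cst.
    apply: measurable_funV_gt0 => //; apply: measurable_fun_sqrt.
    by apply: measurable_funM => //; exact: measurable_energy.
  case=> -[|[|[|[|//]]]] ? /=; apply: measurable_funM => //.
  + exact: measurable_R3_1.
  + exact: measurable_R3_2.
- move=> k; rewrite tE -[Num.sqrt _ * _]expr2 sqr_sqrtr ?(ltW (X0 _))//.
  have -> : dot3 k k = e k ^+ 2 - m ^+ 2 by rewrite energy_sqr norm3_sqr; ring.
  by rewrite /X; field; rewrite !gt_eqF ?energy_gt0.
- move=> k p; rewrite tE mulr_ge0//.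
  have := dot3_geN k p.
  have := ler_pM (norm3_ge0 k) (norm3_ge0 p) (ltW (norm3_lt_energy k)) (ltW (norm3_lt_energy p)).
  have := mulr_gt0 m0 (energy_gt0 p); have := mulr_gt0 m0 (energy_gt0 k).
  by have := sqr_ge0 m; lra.
(* Since [dot3 k0 p >= - e k0 * e p], the factor [(m + e k0) * (m + e p) + dot3 k0 p] is at least
   [m * (m + e p)], and [m + e p] dominates the remaining denominator [Num.sqrt (X p)]. *)
- move=> k0; exists (2^-1 * m / Num.sqrt (X k0)); first by rewrite divr_gt0// mulr_gt0.
  move=> p; rewrite tE.
  have sXle : Num.sqrt (X p) <= m + e p.
    rewrite -ler_sqr ?nnegrE ?sqrtr_ge0 ?(ltW (me _))// sqr_sqrtr ?(ltW (X0 _))//.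
    by rewrite /X expr2 ler_wpM2r ?(ltW (me _))// lerDr ltW.
  rewrite invfM -!mulrA ler_pM2l// (mulrC m) ler_pM2l ?invr_gt0//.
  rewrite mulrC ler_pdivlMr//.
  apply: (le_trans (ler_wpM2l (ltW m0) sXle)).
  have := dot3_geN k0 p.
  have := ler_pM (norm3_ge0 k0) (norm3_ge0 p) (ltW (norm3_lt_energy k0)) (ltW (norm3_lt_energy p)).
  have := mulr_gt0 m0 (energy_gt0 p); have := mulr_gt0 m0 (energy_gt0 k0).
  by have := sqr_ge0 m; lra.
- exists (4 * m)^-1; first by rewrite invr_ge0 mulr_ge0// ltW.
  move=> k p; apply: decay_estimate; rewrite tE.
  pose S := Num.sqrt (X k) * Num.sqrt (X p).
  have S0 : 0 < S by rewrite mulr_gt0.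
  have S2 : S ^+ 2 = X k * X p by rewrite exprMn !sqr_sqrtr ?(ltW (X0 _)).
  have ek := energy_gt0 k; have ep := energy_gt0 p.
  (* The arithmetic-geometric mean inequality for two factors with product [S ^+ 2], paired so that
     subtracting [(m + e k) * (m + e p)] leaves exactly [e k * e p - m ^+ 2], the expression in
     [energyM_le]. *)
  have S2le : 2 * S <= e k * (m + e p) + e p * (m + e k).
    rewrite -ler_sqr ?nnegrE ?addr_ge0 ?mulr_ge0 ?(ltW S0) ?(ltW (me _)) ?(ltW ek) ?(ltW ep)//.
    rewrite exprMn S2 /X.
    have := sqr_ge0 (e k * (m + e p) - e p * (m + e k)).
    by move: (e k) (e p) => x y; lra.
  have leS : e k * e p <= S.
    rewrite -ler_sqr ?nnegrE ?mulr_ge0 ?(ltW S0) ?(ltW ek) ?(ltW ep)// S2 /X exprMn.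
    by rewrite ler_pM ?sqr_ge0// expr2 ler_wpM2l ?(ltW ek) ?(ltW ep)// lerDr ltW.
  rewrite -/S [leLHS](_ : _ = 2^-1 * (2 * S - (m + e k) * (m + e p) - dot3 k p) / S); last first.
    by field; rewrite gt_eqF.
  apply: (@le_trans _ _ (4^-1 * norm3 (p - k) ^+ 2 / S)).
    rewrite ler_pM2r ?invr_gt0//.
    by have := energyM_le k p; lra.
  apply: ler_wpM2l; first by rewrite mulr_ge0// sqr_ge0.
  by rewrite lef_pV2 ?posrE ?mulr_gt0.
Qed.

End kernels.

(** * Tonelli for nonnegative iterated integrals over R^3 *)

Section nonneg_iterated.
Context {R : realType}.
Notation V := (R3 R).
Local Open Scope ereal_scope.

(* [g] is only ever evaluated at measurable functions of a parameter, so that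
   measurability on all nestings of the product follows uniformly. *)
Definition jointly_measurable (g : V -> V -> R) :=
  forall d (T : measurableType d) (a b : T -> V), measurable_fun setT a ->
    measurable_fun setT b -> measurable_fun setT (fun x => g (a x) (b x)).

Definition jointly_measurable3 (g : V -> V -> V -> R) :=
  forall d (T : measurableType d) (a b c : T -> V), measurable_fun setT a ->
    measurable_fun setT b -> measurable_fun setT c ->
    measurable_fun setT (fun x => g (a x) (b x) (c x)).

Lemma jointly_measurable_l g k : jointly_measurable g ->
  measurable_fun setT (g k).
Proof. by move=> mg; apply: mg => //; exact: measurable_cst. Qed.

Lemma jointly_measurable_r g p : jointly_measurable g ->
  measurable_fun setT (g ^~ p).
Proof. by move=> mg; apply: mg => //; exact: measurable_cst. Qed.

Lemma measurable_fun_ge0_integral g : jointly_measurable g ->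
  (forall x y, (0 <= g x y)%R) ->
  measurable_fun setT (fun x => \int[vol]_y (g x y)%:E).
Proof.
move=> mg g0; apply: (measurable_fun_fubini_tonelli_F (fun z : V * V => (g z.1 z.2)%:E)).
  by apply/measurable_EFinP; apply: mg.
by move=> z; rewrite lee_fin.
Qed.

Lemma ge0_integral_swap g : jointly_measurable g ->
  (forall x y, (0 <= g x y)%R) ->
  \int[vol]_x \int[vol]_y (g x y)%:E = \int[vol]_y \int[vol]_x (g x y)%:E.
Proof.
move=> mg g0.
apply: (fubini_tonelli (m1 := vol) (m2 := vol) (fun z : V * V => (g z.1 z.2)%:E)).
  by apply/measurable_EFinP; apply: mg.
by move=> z; rewrite lee_fin.
Qed.

Lemma ge0_integral_rot3 g : jointly_measurable3 g ->
  (forall x y z, (0 <= g x y z)%R) ->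
  \int[vol]_x \int[vol]_y \int[vol]_z (g x y z)%:E =
  \int[vol]_y \int[vol]_z \int[vol]_x (g x y z)%:E.
Proof.
move=> mg g0.
transitivity (\int[vol]_y \int[vol]_x \int[vol]_z (g x y z)%:E).
  apply: (fubini_tonelli (m1 := vol) (m2 := vol)
    (fun w : V * V => \int[vol]_z (g w.1 w.2 z)%:E)).
    apply: (measurable_fun_fubini_tonelli_F (fun w : V * V * V => (g w.1.1 w.1.2 w.2)%:E)).
      apply/measurable_EFinP; apply: mg => //.
        exact: (measurableT_comp measurable_fst measurable_fst).
      exact: (measurableT_comp measurable_snd measurable_fst).
    by move=> w; rewrite lee_fin.
  by move=> w; apply: integral_ge0 => z _; rewrite lee_fin.
apply: eq_integral => y _; apply: ge0_integral_swap => //.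
by move=> d T a b ma mb; apply: mg => //; exact: measurable_cst.
Qed.

Lemma ge0_integral_conv (g : V -> V -> R) : jointly_measurable g ->
  (forall x y, (0 <= g x y)%R) ->
  \int[vol]_p \int[vol]_k (g k p)%:E =
  \int[vol]_h \int[vol]_k (g k (k + h)%R)%:E.
Proof.
move=> mg g0.
transitivity (\int[vol]_k \int[vol]_p (g k p)%:E).
  apply: (@ge0_integral_swap (fun p k => g k p)) => //.
  by move=> d T a b ma mb; exact: mg.
transitivity (\int[vol]_k \int[vol]_h (g k (k + h)%R)%:E).
  apply: eq_integral => k _; rewrite -(@ge0_integral_vol_shift _ (fun p => (g k p)%:E) k).
  - by apply: eq_integral => h _; rewrite addrC.
  - by apply/measurable_EFinP; exact: jointly_measurable_l.
  - by move=> p; rewrite lee_fin.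
apply: (@ge0_integral_swap (fun k h => g k (k + h)%R)) => //.
by move=> d T a b ma mb; apply: mg => //; exact: measurable_funD_R3.
Qed.

End nonneg_iterated.

(** * The position density and its integral against the weight *)

Section density.
Context {R : realType}.
Notation V := (R3 R).
Variables (t : V -> V -> R) (f : V -> R).
Hypotheses (vt : slowly_varying_kernel t) (f0 : forall p, 0 <= f p).
Hypothesis mf : measurable_fun setT f.
Hypothesis intf : vol.-integrable setT (EFin \o f).

Definition weighted_kernel k p := t k p * f k * f p.

Let M := weighted_kernel.

Let M0 k p : 0 <= M k p.
Proof. by rewrite /M /weighted_kernel !mulr_ge0 ?(svk_ge0 vt). Qed.

Let M_le k p : M k p <= f p * f k.
Proof.
by rewrite /M /weighted_kernel -mulrA mulrC (mulrC (f p)) ler_piMr ?mulr_ge0// (svk_le1 vt).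
Qed.

Lemma measurable_weighted_kernel : jointly_measurable M.
Proof.
move=> d T a b ma mb; apply: measurable_funM; last exact: (measurableT_comp mf).
apply: measurable_funM; last exact: (measurableT_comp mf).
exact: (measurable_fun_svk vt).
Qed.
Let mM := measurable_weighted_kernel.

Lemma measurable_funB_R3 d (T : measurableType d) (g h : T -> V) :
  measurable_fun setT g -> measurable_fun setT h ->
  measurable_fun setT (fun x => g x - h x : V).
Proof. by move=> mg mh; apply: measurable_funD_R3 => //; exact: measurable_funN_R3. Qed.

Let mcosM : jointly_measurable3 (fun y p k => M k p * cos (dot3 (p - k) y)).
Proof.
move=> d T a b c ma mb mc; apply: measurable_funM; first exact: mM.
by apply: measurable_cos_dot3 => //; exact: measurable_funB_R3.
Qed.

Let mpcosM : jointly_measurable3 (fun y p k => M k p * (1 + cos (dot3 (p - k) y))).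
Proof.
move=> d T a b c ma mb mc; apply: measurable_funM; first exact: mM.
apply: measurable_funD; first exact: measurable_cst.
by apply: measurable_cos_dot3 => //; exact: measurable_funB_R3.
Qed.

Let pcos0 (a : R) : 0 <= 1 + cos a.
Proof. by rewrite -lerBlDl sub0r cos_geN1. Qed.

Let pcosM0 y p k : 0 <= M k p * (1 + cos (dot3 (p - k) y)).
Proof. by rewrite mulr_ge0. Qed.

Definition slice_transform p y := \int[vol]_k (M k p * cos (dot3 (p - k) y)).

(* The Fourier transform of the weighted kernel along the antidiagonal; up to
   [(2 * pi) ^- 3] it is the position density of the POL. *)
Definition density y := \int[vol]_p slice_transform p y.

Let integrable_cosM p y :
  vol.-integrable setT (EFin \o (fun k => M k p * cos (dot3 (p - k) y))).
Proof.
apply: (le_integrable measurableT (g := fun k => (f p)%:E * (f k)%:E)%E).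
- by apply/measurable_EFinP; apply: mcosM => //; exact: measurable_cst.
- move=> k _ /=; rewrite lee_fin normrM (ger0_norm (M0 _ _)) [leRHS]ger0_norm ?mulr_ge0//.
  apply: (le_trans _ (M_le k p)); rewrite ler_piMr// ler_norml cos_geN1 cos_le1//.
- exact: integrableZl.
Qed.

(** The oscillating transform is tied to a nonnegative integrand; all three quantities are finite,
    so it can be recovered by subtraction. *)
Let slice_plus p y : (\int[vol]_k (M k p * (1 + cos (dot3 (p - k) y)))%:E =
  (slice_transform p 0 + slice_transform p y)%:E)%E.
Proof.
rewrite /slice_transform /Rintegral EFinD !fineK ?integrable_fin_num//; first last.
- exact: integrable_cosM.
- exact: integrable_cosM.
rewrite -integralD_EFin//.
apply: eq_integral => k _ /=; rewrite -EFinD; congr EFin.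
by rewrite (_ : dot3 _ 0 = 0) ?cos0; rewrite /dot3/=; ring.
Qed.

Let slice_le p y : `|slice_transform p y| <= f p * \int[vol]_k f k.
Proof.
apply: (le_trans (le_normr_Rintegral measurableT (integrable_cosM p y))).
rewrite -RintegralZl//; apply: le_Rintegral => //.
- exact: (integrable_norm (integrable_cosM p y)).
- rewrite (_ : _ \o _ = (fun k => (f p)%:E * (f k)%:E)%E); last by apply/funext.
  exact: integrableZl.
- move=> k _; rewrite normrM (ger0_norm (M0 _ _)).
  apply: (le_trans _ (M_le k p)); rewrite ler_piMr// ler_norml cos_geN1 cos_le1//.
Qed.

Let measurable_slice : jointly_measurable slice_transform.
Proof.
move=> d T a b ma mb.
have ms : jointly_measurable (fun p y =>
    fine (\int[vol]_k (M k p * (1 + cos (dot3 (p - k) y)))%:E)%E).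
  move=> d' T' a' b' ma' mb'; apply: (measurableT_comp (f := fine)) => //.
  apply: (measurable_fun_fubini_tonelli_F (fun w : T' * V =>
    (M w.2 (a' w.1) * (1 + cos (dot3 (a' w.1 - w.2) (b' w.1))))%:E)).
    apply/measurable_EFinP; apply: mpcosM => //.
      exact: (measurableT_comp mb').
    exact: (measurableT_comp ma').
  by move=> w; rewrite lee_fin.
(* At frequency 0 the nonnegative integral equals twice [slice_transform p 0], hence the division by
   2. *)
rewrite (_ : (fun _ => _) = (fun x =>
  fine (\int[vol]_k (M k (a x) * (1 + cos (dot3 (a x - k) (b x))))%:E)%E -
  fine (\int[vol]_k (M k (a x) * (1 + cos (dot3 (a x - k) 0)))%:E)%E / 2)); last first.
  by apply/funext => x; rewrite !slice_plus/=; field.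
apply: measurable_funB; first exact: ms.
apply: measurable_funM; last exact: measurable_cst.
by apply: ms => //; exact: measurable_cst.
Qed.

Let integrable_slice y :
  vol.-integrable setT (EFin \o (slice_transform ^~ y)).
Proof.
apply: (le_integrable measurableT (g := fun p => (\int[vol]_k f k)%:E * (f p)%:E)%E).
- by apply/measurable_EFinP; apply: measurable_slice => //; exact: measurable_cst.
- move=> p _ /=; rewrite lee_fin [leRHS]ger0_norm; first by rewrite mulrC slice_le.
  by rewrite mulr_ge0// Rintegral_ge0.
- exact: integrableZl.
Qed.

Let density_plus y :
  (\int[vol]_p \int[vol]_k (M k p * (1 + cos (dot3 (p - k) y)))%:E =
  (density 0 + density y)%:E)%E.
Proof.
under eq_integral do rewrite slice_plus EFinD.
rewrite integralD_EFin//.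
by rewrite EFinD /density /Rintegral !fineK ?integrable_fin_num//; exact: integrable_slice.
Qed.

Lemma measurable_density : measurable_fun setT density.
Proof.
rewrite (_ : density = (fun y =>
  fine (\int[vol]_p \int[vol]_k (M k p * (1 + cos (dot3 (p - k) y)))%:E)%E -
  density 0)); last first.
  apply/funext => y; rewrite density_plus -[fine _]/(density 0 + density y).
  by rewrite addrAC subrr add0r.
apply: measurable_funB; last exact: measurable_cst.
apply: (measurableT_comp (f := fine)) => //.
apply: (measurable_fun_fubini_tonelli_F (fun w : V * V =>
  \int[vol]_k (M k w.2 * (1 + cos (dot3 (w.2 - k) w.1)))%:E)%E).
  apply: (measurable_fun_fubini_tonelli_F (fun z : V * V * V =>
    (M z.2 z.1.2 * (1 + cos (dot3 (z.1.2 - z.2) z.1.1)))%:E)).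
    apply/measurable_EFinP; apply: mpcosM => //.
      exact: (measurableT_comp measurable_fst measurable_fst).
    exact: (measurableT_comp measurable_snd measurable_fst).
  by move=> z; rewrite lee_fin.
by move=> z; apply: integral_ge0 => k _; rewrite lee_fin.
Qed.

(** The double integral factors into the sum of the squares of the integrals of the [u i]. *)
Lemma Rintegral_gram_ge0 (I : finType) (u : I -> V -> R) :
  (forall i, vol.-integrable setT (EFin \o u i)) ->
  0 <= \int[vol]_p \int[vol]_k (\sum_i u i k * u i p).
Proof.
move=> iu.
have sumE (c : I -> R) : \int[vol]_k (\sum_i u i k * c i) =
    \sum_i (\int[vol]_k u i k) * c i.
  rewrite /Rintegral; under eq_integral do rewrite -sumEFin.
  have iuc i : vol.-integrable setT (fun k => (u i k * c i)%:E).
    by rewrite (_ : (fun _ => _) = (EFin \o u i) \* cst (c i)%:E)%E//; exact: integrableZr.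
  rewrite integral_sum// -sum_fine => [|i _]; last exact: integrable_fin_num.
  by apply: eq_bigr => i _; rewrite -[LHS]/(\int[vol]_k (u i k * c i)) RintegralZr.
under eq_Rintegral do rewrite sumE.
under eq_Rintegral do under eq_bigr do rewrite mulrC.
by rewrite sumE; apply: sumr_ge0 => i _; rewrite -expr2 sqr_ge0.
Qed.

(** By the addition formula for [cos (dot3 p y - dot3 k y)], the integrand is a Gram form in the
    features [w i * f], each multiplied once by a cosine and once by a sine; the boolean selects
    which. *)
Lemma density_ge0 y : 0 <= density y.
Proof.
have [n [w [mw tE]]] := svk_feature vt.
(* The squares of the features add up to [t k k = 1], which makes every [u ib] dominated by [f]. *)
have w1 i k : `|w i k| <= 1.
  rewrite -(ler_sqr (_ : _ \is Num.nneg)) ?nnegrE// expr1n real_normK ?num_real//.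
  rewrite -(svk_diag vt k) tE (bigD1 i)//= -expr2 lerDl sumr_ge0// => j _.
  by rewrite -expr2 sqr_ge0.
pose u (ib : 'I_n * bool) k :=
  w ib.1 k * f k * (if ib.2 then cos (dot3 k y) else sin (dot3 k y)).
have iu ib : vol.-integrable setT (EFin \o u ib).
  apply: (le_integrable measurableT (g := EFin \o f)) => //.
    apply/measurable_EFinP; apply: measurable_funM; first exact: measurable_funM.
    case: ib.2; first by apply: measurable_cos_dot3 => //; exact: measurable_cst.
    apply: (measurableT_comp (f := @sin R)).
      by apply: continuous_measurable_fun; exact: continuous_sin.
    by apply: measurable_fun_dot3 => //; exact: measurable_cst.
  move=> k _ /=; rewrite lee_fin /u !normrM (ger0_norm (f0 k)).
  rewrite -[leRHS]mul1r -[leRHS]mulr1; apply: ler_pM; rewrite ?mulr_ge0// ?ler_pM//.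
  by case: ib.2; rewrite ler_norml ?cos_geN1 ?cos_le1 ?sin_geN1 ?sin_le1.
have := Rintegral_gram_ge0 iu; congr (_ <= _).
apply: eq_Rintegral => p _; apply: eq_Rintegral => k _.
rewrite -(pair_bigA _ (fun i b => u (i, b) k * u (i, b) p))/=.
rewrite /M /weighted_kernel tE !mulr_suml; apply: eq_bigr => i _.
rewrite big_bool/= /u/=.
have -> : dot3 (p - k) y = dot3 p y - dot3 k y by rewrite /dot3/=; ring.
by rewrite cosB; ring.
Qed.

(** Tonelli is applied to [1 + cos], and both sides then contain the same finite summand
    [8 * density 0], where 8 is the total mass of [expw]. The variable [h] is the momentum
    difference [p - k]. *)
Lemma integral_expw_density :
  (\int[vol]_y (expw y * density y)%:E =
   \int[vol]_h ((cauchyw h)%:E * \int[vol]_k (weighted_kernel k (k + h))%:E))%E.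
Proof.
have d0 : 0 <= density 0 by exact: density_ge0.
have mMK : jointly_measurable (fun k p => M k p * cauchyw (p - k)).
  move=> d T a b ma mb; apply: measurable_funM; first exact: mM.
  by apply: (measurableT_comp measurable_cauchyw); exact: measurable_funB_R3.
have MK0 k p : 0 <= M k p * cauchyw (p - k) by rewrite mulr_ge0// cauchyw_ge0.
have rhsE : (\int[vol]_p \int[vol]_k (M k p * cauchyw (p - k))%:E =
   \int[vol]_h ((cauchyw h)%:E * \int[vol]_k (weighted_kernel k (k + h))%:E))%E.
  rewrite ge0_integral_conv//; apply: eq_integral => h _.
  rewrite -ge0_integralZl_EFin ?cauchyw_ge0//.
  - apply: eq_integral => k _; rewrite -EFinM mulrC; congr (_ * _)%:E.
    by rewrite addrAC subrr add0r.
  - by move=> k _; rewrite lee_fin.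
  - apply/measurable_EFinP; apply: mM => //.
    by apply: measurable_funD_R3 => //; exact: measurable_cst.
have M00 : (\int[vol]_p \int[vol]_k (M k p)%:E = (density 0)%:E)%E.
  have sE p : (\int[vol]_k (M k p)%:E = (slice_transform p 0)%:E)%E.
    rewrite /slice_transform /Rintegral fineK; last first.
      by apply: integrable_fin_num => //; exact: integrable_cosM.
    apply: eq_integral => k _.
    by rewrite (_ : dot3 _ 0 = 0) ?cos0 ?mulr1//; rewrite /dot3/=; ring.
  rewrite (eq_integral (fun p => (slice_transform p 0)%:E)) => [|p _]; last exact: sE.
  rewrite /density /Rintegral fineK//.
  by apply: integrable_fin_num => //; exact: integrable_slice.
have : (\int[vol]_y \int[vol]_p \int[vol]_k (expw y * (M k p * (1 + cos (dot3 (p - k) y))))%:E =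
  \int[vol]_p \int[vol]_k (8 * M k p + M k p * cauchyw (p - k))%:E)%E.
  rewrite (@ge0_integral_rot3 _ (fun y p k => expw y * (M k p * (1 + cos (dot3 (p - k) y))))).
  - apply: eq_integral => p _; apply: eq_integral => k _.
    rewrite -integral_expw_cos ?M0 ?lexx//.
    by apply: eq_integral => y _; congr (_ * _)%:E; ring.
  - move=> d T a b c ma mb mc; apply: measurable_funM; last exact: mpcosM.
    exact: (measurableT_comp measurable_expw).
  - by move=> y p k; rewrite mulr_ge0 ?expw_ge0.
have -> : (\int[vol]_y \int[vol]_p \int[vol]_k
    (expw y * (M k p * (1 + cos (dot3 (p - k) y))))%:E =
    (8 * density 0)%:E + \int[vol]_y (expw y * density y)%:E)%E.
  transitivity (\int[vol]_y ((density 0 * expw y)%:E + (expw y * density y)%:E))%E.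
    apply: eq_integral => y _.
    rewrite -EFinD (_ : density 0 * _ + _ = expw y * (density 0 + density y)); last first.
      by rewrite mulrDr (mulrC (density 0)).
    rewrite EFinM -(density_plus y) -ge0_integralZl_EFin ?expw_ge0//; last 2 first.
    - by move=> p _; apply: integral_ge0 => k _; rewrite lee_fin.
    - apply: (@measurable_fun_ge0_integral _ (fun p k => M k p * (1 + cos (dot3 (p - k) y)))) => //.
      by move=> d T a b ma mb; apply: mpcosM => //; exact: measurable_cst.
    apply: eq_integral => p _; rewrite -ge0_integralZl_EFin ?expw_ge0//.
    - by move=> k _; rewrite lee_fin.
    - by apply/measurable_EFinP; apply: mpcosM => //; exact: measurable_cst.
  rewrite ge0_integralD//.
  - congr (_ + _)%E; under eq_integral do rewrite EFinM.
    rewrite ge0_integralZl_EFin ?integral_expw -?EFinM ?(mulrC 8)//.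
    + by move=> y _; rewrite lee_fin expw_ge0.
    + by apply/measurable_EFinP; exact: measurable_expw.
  - by move=> y _; rewrite lee_fin mulr_ge0 ?expw_ge0.
  - apply/measurable_EFinP; apply: measurable_funM; first exact: measurable_cst.
    exact: measurable_expw.
  - by move=> y _; rewrite lee_fin mulr_ge0 ?expw_ge0 ?density_ge0.
  - apply/measurable_EFinP; apply: measurable_funM; first exact: measurable_expw.
    exact: measurable_density.
have -> : (\int[vol]_p \int[vol]_k (8 * M k p + M k p * cauchyw (p - k))%:E =
    (8 * density 0)%:E + \int[vol]_p \int[vol]_k (M k p * cauchyw (p - k))%:E)%E.
  transitivity (\int[vol]_p (8%:E * \int[vol]_k (M k p)%:E +
      \int[vol]_k (M k p * cauchyw (p - k))%:E))%E.
    apply: eq_integral => p _; under eq_integral do rewrite EFinD EFinM.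
    have mMp : measurable_fun setT (fun k => (M k p)%:E).
      by apply/measurable_EFinP; exact: jointly_measurable_r.
    rewrite ge0_integralD//.
    - by rewrite ge0_integralZl_EFin// => k _; rewrite lee_fin.
    - by move=> k _; rewrite -EFinM lee_fin mulr_ge0.
    - exact: measurable_funeM.
    - by move=> k _; rewrite lee_fin.
    - by apply/measurable_EFinP; exact: (@jointly_measurable_r _ _ p mMK).
  have mp g : jointly_measurable g -> (forall k p, 0 <= g k p) ->
      measurable_fun setT (fun p : V => \int[vol]_k (g k p)%:E)%E.
    move=> mg g0; apply: (@measurable_fun_ge0_integral _ (fun p k => g k p)) => //.
    by move=> d T a b ma mb; exact: mg.
  have ip (g : V -> V -> R) p : (forall k p, 0 <= g k p) -> (0 <= \int[vol]_k (g k p)%:E)%E.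
    by move=> g0; apply: integral_ge0 => k _; rewrite lee_fin.
  rewrite ge0_integralD//.
  - rewrite ge0_integralZl_EFin//.
    + by rewrite M00 -EFinM.
    + by move=> p _; exact: ip.
    + exact: mp.
  - by move=> p _; rewrite mule_ge0// ip.
  - by apply: measurable_funeM; exact: mp.
  - by move=> p _; exact: (ip (fun k p => M k p * cauchyw (p - k))).
  - exact: (mp _ mMK).
rewrite rhsE ![((8 * density 0)%:E + _)%E]addeC.
by move=> /(congr1 (fun z => z - (8 * density 0)%:E)%E); rewrite !addeK.
Qed.

End density.

(** * Calculus of finite integrals of nonnegative functions *)

Section has_integral.
Context {R : realType}.
Notation V := (R3 R).
Implicit Types (f g : V -> R) (a b c : R).

(** With measurability, nonnegativity and finiteness bundled, an inequality between integrals
    reduces to a pointwise one and the arithmetic takes place in the reals. *)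
Definition has_integral f a := [/\ measurable_fun setT f, (forall x, 0 <= f x) &
  (\int[vol]_x (f x)%:E = a%:E)%E].

Lemma has_integralD f g a b : has_integral f a -> has_integral g b ->
  has_integral (fun x => f x + g x) (a + b).
Proof.
move=> [mf f0 fa] [mg g0 gb]; split; first exact: measurable_funD.
  by move=> x; rewrite addr_ge0.
under eq_integral do rewrite EFinD.
rewrite ge0_integralD// ?fa ?gb//.
- by move=> x _; rewrite lee_fin.
- exact/measurable_EFinP.
- by move=> x _; rewrite lee_fin.
- exact/measurable_EFinP.
Qed.

Lemma has_integralZ c f a : 0 <= c -> has_integral f a ->
  has_integral (fun x => c * f x) (c * a).
Proof.
move=> c0 [mf f0 fa]; split.
- by apply: measurable_funM => //; exact: measurable_cst.
- by move=> x; rewrite mulr_ge0.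
under eq_integral do rewrite EFinM.
rewrite ge0_integralZl_EFin// ?fa//.
- by move=> x _; rewrite lee_fin.
- exact/measurable_EFinP.
Qed.

Lemma has_integral_ge0 f a : has_integral f a -> 0 <= a.
Proof.
by move=> [mf f0 fa]; rewrite -lee_fin -fa integral_ge0// => x _; rewrite lee_fin.
Qed.

Lemma has_integral_le f g a b : has_integral f a -> has_integral g b ->
  (forall x, f x <= g x) -> a <= b.
Proof.
move=> [mf f0 fa] [mg g0 gb] fg; rewrite -lee_fin -fa -gb; apply: ge0_le_integral => //.
- by move=> x _; rewrite lee_fin.
- exact/measurable_EFinP.
- exact/measurable_EFinP.
- by move=> x _; rewrite lee_fin.
Qed.

Lemma has_integral_dom f g b : measurable_fun setT f -> (forall x, 0 <= f x) ->
  has_integral g b -> (forall x, f x <= g x) ->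
  has_integral f (\int[vol]_x f x).
Proof.
move=> mf f0 [mg g0 gb] fg; split => //.
rewrite /Rintegral fineK// ge0_fin_numE; last first.
  by apply: integral_ge0 => x _; rewrite lee_fin.
apply: (@le_lt_trans _ _ b%:E); last exact: ltry.
rewrite -gb; apply: ge0_le_integral => //.
- by move=> x _; rewrite lee_fin.
- exact/measurable_EFinP.
- exact/measurable_EFinP.
- by move=> x _; rewrite lee_fin.
Qed.

Lemma has_integral_shift f a h : has_integral f a ->
  has_integral (fun x => f (x + h)) a.
Proof.
move=> [mf f0 fa]; split => //.
  apply: (measurableT_comp mf).
  by apply: measurable_funD_R3 => //; exact: measurable_cst.
rewrite (@ge0_integral_vol_shift _ (fun x => (f x)%:E))//.
exact/measurable_EFinP.
Qed.

Lemma has_integral_integrable f a : has_integral f a ->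
  vol.-integrable setT (EFin \o f).
Proof.
move=> [mf f0 fa]; apply/integrableP; split; first exact/measurable_EFinP.
under eq_integral => x _ do rewrite /= ger0_norm//.
by rewrite fa ltry.
Qed.

Lemma has_integral_Rintegral f a : has_integral f a -> \int[vol]_x f x = a.
Proof. by move=> [_ _ fa]; rewrite /Rintegral fa. Qed.

(** The real-valued integral is 0 when the extended one is infinite, so a nonzero value certifies
    finiteness. *)
Lemma has_integral_neq0 f a : measurable_fun setT f -> (forall x, 0 <= f x) ->
  \int[vol]_x f x = a -> a != 0 -> has_integral f a.
Proof.
move=> mf f0 fa a0; split => //; move: fa; rewrite /Rintegral.
have := @integral_ge0 _ _ _ vol setT (fun x => (f x)%:E) (fun x _ => f0 x).
by case: (\int[vol]_x _)%E => [r|_|//] /=; [move=> _ ->|move=> r0; rewrite -r0 eqxx in a0].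
Qed.

Lemma has_integral_restrict f a A : measurable A -> has_integral f a ->
  has_integral (f \_ A) (\int[vol]_(x in A) f x).
Proof.
move=> mA hf; have [mf f0 _] := hf; rewrite Rintegral_mkcond.
have rE x : (f \_ A) x = if x \in A then f x else 0 by [].
apply: (has_integral_dom _ _ hf).
- by apply/(measurable_restrictT _ _).1 => //; exact: measurable_funTS.
- by move=> x; rewrite rE; case: ifP.
- by move=> x; rewrite rE; case: ifP.
Qed.

End has_integral.

(** * From the weighted mass to the mass of a ball *)

Section localization_bound.
Context {R : realType}.
Notation V := (R3 R).

(** The Euclidean norm is at most the sum of the absolute values of the coordinates. *)
Lemma expw_le (x : V) (r : R) : r <= norm3 x -> expw x <= expR (- r).
Proof.
move=> rx; rewrite /expw -!expRD ler_expR -!opprD lerN2.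
apply: (le_trans rx).
rewrite -ler_sqr ?nnegrE ?norm3_ge0 ?addr_ge0// norm3_sqr /dot3.
have x1 := normr_ge0 x.1.1; have x2 := normr_ge0 x.1.2; have x3 := normr_ge0 x.2.
rewrite -!expr2 -(real_normK (num_real x.1.1)) -(real_normK (num_real x.1.2)).
rewrite -(real_normK (num_real x.2)).
move: `|x.1.1| `|x.1.2| `|x.2| x1 x2 x3 => a b c a0 b0 c0; nra.
Qed.

Lemma expw_le1 (x : V) : expw x <= 1.
Proof. by rewrite -(expR0 R) -oppr0; apply: expw_le; exact: norm3_ge0. Qed.

Variables (t : V -> V -> R) (f : V -> R).
Hypotheses (vt : slowly_varying_kernel t) (f0 : forall p, 0 <= f p).
Hypothesis mf : measurable_fun setT f.
Hypothesis intf : vol.-integrable setT (EFin \o f).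
Notation C3 := ((2 * pi) ^+ 3 : R).

Let C30 : 0 < C3. Proof. by rewrite exprn_gt0// mulr_gt0// pi_gt0. Qed.

Let measurable_density_shift (b : V) : measurable_fun setT (fun x : V => density t f (x - b)).
Proof.
apply: (measurableT_comp (measurable_density vt f0 mf intf)).
by apply: measurable_funD_R3 => //; exact: measurable_cst.
Qed.

(* Markov's inequality for the weight [1 - expw], which vanishes at the origin
   only. *)
Lemma ball_density_ge (b : V) (r J : R) : 0 <= r ->
  \int[vol]_x density t f (x - b) = C3 ->
  (\int[vol]_h ((cauchyw h)%:E * \int[vol]_k (weighted_kernel t f k (k + h))%:E) = J%:E)%E ->
  J <= expR (- r) * C3 +
    (1 - expR (- r)) * \int[vol]_(x in open_ball b r) density t f (x - b).
Proof.
move=> r0 DC JE; have mD := measurable_density_shift b.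
pose D x := density t f (x - b).
have D0 x : 0 <= D x by exact: density_ge0.
have hD : has_integral D C3 := has_integral_neq0 mD D0 DC (lt0r_neq0 C30).
have hW : has_integral (fun x => expw (x - b) * D x) J.
  split; last first.
  - rewrite (@ge0_integral_vol_shift _ (fun x => (expw x * density t f x)%:E)).
    + by rewrite (integral_expw_density vt f0 mf intf).
    + apply/measurable_EFinP; apply: measurable_funM; first exact: measurable_expw.
      exact: measurable_density.
    + move=> x; rewrite lee_fin.
      by apply: mulr_ge0; [exact: expw_ge0|exact: density_ge0].
  - by move=> x; rewrite mulr_ge0 ?expw_ge0.
  - apply: measurable_funM => //; apply: (measurableT_comp measurable_expw).
    by apply: measurable_funD_R3 => //; exact: measurable_cst.
have hB := has_integral_restrict (measurable_open_ball b r) hD.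
have e1 : 0 <= 1 - expR (- r) by rewrite subr_ge0 -[leRHS]expR0 ler_expR oppr_le0.
(* The pointwise bound behind this: [expw (x - b)] is at most 1 on the ball and at most [expR (- r)]
   off it, that is, at most [expR (- r)] plus [1 - expR (- r)] times the indicator of the ball. *)
have := has_integralD (has_integralZ (expR_ge0 (- r)) hD) (has_integralZ e1 hB).
move=> /(has_integral_le hW); apply => x.
rewrite (_ : (D \_ _) x = if x \in open_ball b r then D x else 0)//.
have [xB|xB] := boolP (x \in open_ball b r).
  by rewrite -mulrDl subrKC ler_wpM2r// expw_le1.
rewrite mulr0 addr0 ler_wpM2r// expw_le// leNgt.
by apply: contra xB => xr; rewrite inE.
Qed.

End localization_bound.

(** * Gaussian profiles and the limit of their overlaps *)

Section gaussian_profile.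
Context {R : realType}.
Notation V := (R3 R).

Definition gauss3 (n : nat) (p : V) : R := expR (- (norm3 p ^+ 2 / n%:R ^+ 2)).

Lemma measurable_gauss3 n : measurable_fun setT (gauss3 n).
Proof.
apply: (measurableT_comp (@measurable_expR R)); apply: measurable_funN.
apply: measurable_funM; last exact: measurable_cst.
by apply: measurable_funX; exact: measurable_fun_norm3.
Qed.

Lemma gauss3_ge0 n p : 0 <= gauss3 n p. Proof. exact: expR_ge0. Qed.

Lemma gauss3_le1 n p : gauss3 n p <= 1.
Proof. by rewrite -[leRHS]expR0 ler_expR oppr_le0 mulr_ge0 ?invr_ge0 ?sqr_ge0. Qed.

Lemma has_integral_expw : has_integral (@expw R) 8.
Proof.
split; [exact: measurable_expw|exact: expw_ge0|exact: integral_expw].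
Qed.

(** The bound |x| <= x^2/n^2 + n^2/4 in each coordinate; the three constants add up to
    [3 / 4 * n%:R ^+ 2]. Integrability of the Gaussian thus follows from that of [expw]. *)
Let gauss3_le_expw n p : (0 < n)%N ->
  gauss3 n p <= expR (3 / 4 * n%:R ^+ 2) * expw p.
Proof.
move=> n0; have nR : 0 < n%:R :> R by rewrite ltr0n.
rewrite /gauss3 /expw -!expRD ler_expR.
have amgm (x : R) : `|x| <= x ^+ 2 / n%:R ^+ 2 + n%:R ^+ 2 / 4.
  have -> : x ^+ 2 / n%:R ^+ 2 = (`|x| / n%:R) ^+ 2.
    by rewrite expr_div_n real_normK// num_real.
  have {1}-> : `|x| = 2 * ((`|x| / n%:R) * (n%:R / 2)) by field; rewrite gt_eqF.
  have := sqr_ge0 (`|x| / n%:R - n%:R / 2); set u := `|x| / n%:R; lra.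
have := amgm p.1.1; have := amgm p.1.2; have := amgm p.2.
rewrite norm3_sqr /dot3 -!expr2 !mulrDl; lra.
Qed.

Lemma has_integral_gauss3 n : (0 < n)%N ->
  has_integral (gauss3 n) (\int[vol]_x gauss3 n x).
Proof.
move=> n0; apply: (has_integral_dom (measurable_gauss3 n) (gauss3_ge0 n)).
  exact: (has_integralZ (expR_ge0 (3 / 4 * n%:R ^+ 2)) has_integral_expw).
by move=> p; exact: gauss3_le_expw.
Qed.

(** A cube takes the place of a ball because its volume is a product of interval lengths. *)
Definition cube (a : R) : set V := (`[- a, a] `*` `[- a, a] `*` `[- a, a])%classic.

Lemma has_integral_cube (a : R) : 0 <= a -> has_integral \1_(cube a) (8 * a ^+ 3).
Proof.
move=> a0.
have mI : measurable (`[- a, a]%classic : set (measurableTypeR R)) by exact: measurable_itv.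
have mII := measurableX mI mI.
have mC : measurable (cube a) by exact: measurableX.
split; [exact: measurable_indic| by move=> x; rewrite indicE |].
rewrite integral_indic// setIT.
pose I : set (measurableTypeR R) := `[- a, a]%classic.
transitivity (leb2 (I `*` I) * lebesgue_measure I)%E.
  exact: (@product_measure1E _ _ _ _ R leb2 lebesgue_measure _ _ mII mI).
rewrite [leb2 _](_ : _ = (lebesgue_measure I * lebesgue_measure I)%E); last first.
  exact: (@product_measure1E _ _ _ _ R lebesgue_measure lebesgue_measure _ _ mI mI).
rewrite /I lebesgue_measure_itv/= lte_fin.
case: ifPn => [_|]; last first.
  rewrite -leNgt -subr_ge0 => h; have -> : a = 0 by lra.
  by rewrite !mul0e expr0n mulr0.
by rewrite -EFinD -!EFinM; congr EFin; ring.
Qed.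

Lemma notin_cube_norm3 (a : R) (k : V) : k \notin cube a -> a <= norm3 k.
Proof.
move=> kC; rewrite leNgt; apply: contra kC => ka; rewrite inE /cube/=.
have coord (x : R) : x ^+ 2 <= dot3 k k -> - a <= x <= a.
  rewrite -norm3_sqr -(real_normK (num_real x)) ler_sqr ?nnegrE ?norm3_ge0// => xk.
  by rewrite -ler_norml (le_trans xk)// ltW.
rewrite /dot3 -!expr2 in coord.
by split; [split|]; rewrite /= in_itv/=; apply: coord;
  rewrite ?lerDl ?lerDr ?addr_ge0 ?sqr_ge0// -addrA
    ?lerDl ?addr_ge0 ?sqr_ge0// addrCA lerDl addr_ge0 ?sqr_ge0.
Qed.

Lemma in_cube_norm3 (a : R) (k : V) : k \in cube a -> norm3 k ^+ 2 <= 3 * a ^+ 2.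
Proof.
rewrite inE /cube/= => -[[]] /=; rewrite !in_itv/= -!ler_norml => x1 x2 x3.
rewrite norm3_sqr /dot3 -!expr2 -(real_normK (num_real k.1.1)).
rewrite -(real_normK (num_real k.1.2)) -(real_normK (num_real k.2)).
have sq (x : R) : `|x| <= a -> `|x| ^+ 2 <= a ^+ 2.
  by move=> xa; rewrite ler_sqr ?nnegrE// (le_trans _ xa).
have := sq _ x1; have := sq _ x2; have := sq _ x3; lra.
Qed.

Definition gauss_mass (n : nat) : R := \int[vol]_x gauss3 n x ^+ 2.

Lemma has_integral_gauss_mass n : (0 < n)%N ->
  has_integral (fun x => gauss3 n x ^+ 2) (gauss_mass n).
Proof.
move=> n0; apply: (has_integral_dom _ _ (has_integral_gauss3 n0)).
- by apply: measurable_funX; exact: measurable_gauss3.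
- by move=> x; exact: sqr_ge0.
- by move=> x; rewrite expr2 ler_piMr ?gauss3_ge0 ?gauss3_le1.
Qed.

(** On the cube of half-side n, of volume 8 n^3, [norm3 x ^+ 2] is at most 3 n^2, so the squared
    Gaussian is at least e^(-6). *)
Lemma gauss_mass_ge n : (0 < n)%N -> 8 * expR (- 6) * n%:R ^+ 3 <= gauss_mass n.
Proof.
move=> n0; have nR : 0 < n%:R :> R by rewrite ltr0n.
have hc := has_integralZ (expR_ge0 (- 6)) (has_integral_cube (ltW nR)).
rewrite (mulrC 8) -mulrA; apply: (has_integral_le hc (has_integral_gauss_mass n0)) => x.
rewrite indicE; have [xC|_] := boolP (x \in _); last by rewrite mulr0 sqr_ge0.
have x3 : norm3 x ^+ 2 / n%:R ^+ 2 <= 3.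
  by rewrite ler_pdivrMr ?exprn_gt0// in_cube_norm3.
rewrite mulr1 /gauss3 -expRM_natl ler_expR; lra.
Qed.

Lemma gauss_mass_gt0 n : (0 < n)%N -> 0 < gauss_mass n.
Proof.
move=> n0; apply: lt_le_trans (gauss_mass_ge n0).
by rewrite !mulr_gt0 ?expR_gt0 ?exprn_gt0 ?ltr0n.
Qed.

(* The parallelogram identity moves the overlap to the midpoint [k + h / 2]. *)
Lemma has_integral_gauss_overlap n (h : V) : (0 < n)%N ->
  has_integral (fun k => gauss3 n k * gauss3 n (k + h))
    (expR (- (norm3 h ^+ 2 / (2 * n%:R ^+ 2))) * gauss_mass n).
Proof.
move=> n0; have nR : n%:R != 0 :> R by rewrite pnatr_eq0 -lt0n.
pose h2 : V := (h.1.1 / 2, h.1.2 / 2, h.2 / 2).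
have := has_integralZ (expR_ge0 (- (norm3 h ^+ 2 / (2 * n%:R ^+ 2))))
  (has_integral_shift h2 (has_integral_gauss_mass n0)).
congr has_integral; apply/funext => k.
rewrite /gauss3 -expRM_natl -!expRD; congr expR.
by rewrite !norm3_sqr /dot3/=; field.
Qed.

Variables (t : V -> V -> R) (vt : slowly_varying_kernel t) (k0 : V).

Definition profile n p : R := gauss3 n p * t k0 p.

Lemma measurable_profile n : measurable_fun setT (profile n).
Proof.
apply: measurable_funM; first exact: measurable_gauss3.
by apply: (measurable_fun_svk vt) => //; exact: measurable_cst.
Qed.

Lemma profile_ge0 n p : 0 <= profile n p.
Proof. by rewrite mulr_ge0 ?gauss3_ge0 ?(svk_ge0 vt). Qed.

Lemma profile_le n p : profile n p <= gauss3 n p.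
Proof. by rewrite ler_piMr ?gauss3_ge0 ?(svk_le1 vt). Qed.

Lemma has_integral_profile n : (0 < n)%N ->
  has_integral (profile n) (\int[vol]_x profile n x).
Proof.
move=> n0; apply: (has_integral_dom _ _ (has_integral_gauss3 n0)).
- exact: measurable_profile.
- exact: profile_ge0.
- exact: profile_le.
Qed.

Definition profile_mass n : R := \int[vol]_x profile n x ^+ 2.

Lemma has_integral_profile_mass n : (0 < n)%N ->
  has_integral (fun p => profile n p ^+ 2) (profile_mass n).
Proof.
move=> n0; apply: (has_integral_dom _ _ (has_integral_gauss_mass n0)).
- by apply: measurable_funX; exact: measurable_profile.
- by move=> x; exact: sqr_ge0.
- by move=> x; rewrite ler_sqr ?nnegrE ?profile_ge0 ?gauss3_ge0 ?profile_le.
Qed.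

(** The constant is independent of n, so an error that is small relative to the Gaussian mass is
    also small relative to the profile mass. *)
Lemma profile_mass_ge : exists2 d : R, 0 < d &
  forall n, (0 < n)%N -> d * gauss_mass n <= profile_mass n.
Proof.
have [d d0 dt] := svk_lower vt k0; exists (d ^+ 2); first exact: exprn_gt0.
move=> n n0; have h := has_integralZ (sqr_ge0 d) (has_integral_gauss_mass n0).
apply: (has_integral_le h (has_integral_profile_mass n0)) => p.
rewrite -exprMn ler_sqr ?nnegrE ?mulr_ge0 ?gauss3_ge0 ?(ltW d0)// ?(svk_ge0 vt)//.
by rewrite mulrC ler_wpM2l ?gauss3_ge0.
Qed.

Lemma profile_mass_gt0 n : (0 < n)%N -> 0 < profile_mass n.
Proof.
move=> n0; have [d d0 /(_ n n0)] := profile_mass_ge.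
by apply: lt_le_trans; rewrite mulr_gt0 ?gauss_mass_gt0.
Qed.

Let overlap n h k := t k (k + h) * profile n k * profile n (k + h).

Let overlap_ge0 n h k : 0 <= overlap n h k.
Proof.
rewrite /overlap; apply: mulr_ge0; last exact: profile_ge0.
by apply: mulr_ge0; [exact: (svk_ge0 vt)|exact: profile_ge0].
Qed.

Let measurable_shift (h : V) : measurable_fun setT (fun k : V => k + h).
Proof. by apply: measurable_funD_R3 => //; exact: measurable_cst. Qed.

Let measurable_overlap n h : measurable_fun setT (overlap n h).
Proof.
apply: measurable_funM; first apply: measurable_funM.
- exact: (measurable_fun_svk vt (@measurable_id _ _ setT) (measurable_shift h)).
- exact: measurable_profile.
- exact: (measurableT_comp (measurable_profile n) (measurable_shift h)).
Qed.

Let overlap_le n h k :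
  overlap n h k <= 2^-1 * profile n k ^+ 2 + 2^-1 * profile n (k + h) ^+ 2.
Proof.
apply: (@le_trans _ _ (profile n k * profile n (k + h))).
  rewrite /overlap -mulrA ler_piMl ?(svk_le1 vt)//.
  by apply: mulr_ge0; exact: profile_ge0.
have := sqr_ge0 (profile n k - profile n (k + h)); lra.
Qed.

Let has_integral_halves n h : (0 < n)%N ->
  has_integral (fun k => 2^-1 * profile n k ^+ 2 + 2^-1 * profile n (k + h) ^+ 2)
    (profile_mass n).
Proof.
move=> n0; have hN := has_integral_profile_mass n0.
have h2 : 0 <= 2^-1 :> R by [].
have := has_integralD (has_integralZ h2 hN) (has_integralZ h2 (has_integral_shift h hN)).
by congr has_integral; lra.
Qed.

Lemma has_integral_overlap n h : (0 < n)%N ->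
  has_integral (overlap n h) (\int[vol]_k overlap n h k).
Proof.
move=> n0; exact: (has_integral_dom (measurable_overlap n h) (overlap_ge0 n h)
  (has_integral_halves h n0) (overlap_le n h)).
Qed.

Lemma overlap_le_mass n h : (0 < n)%N ->
  \int[vol]_k overlap n h k <= profile_mass n.
Proof.
move=> n0; exact: (has_integral_le (has_integral_overlap h n0)
  (has_integral_halves h n0) (overlap_le n h)).
Qed.

(** With f = G t(k0,.) at k and f', G' at k + h, the loss (f^2 + f'^2)/2 - t f f' equals (f -
    f')^2/2 + (1 - t) f f'. By [svk_lipschitz] it is at most 2 (G - G')^2 + 4 (1 - t) G^2. The first
    term is controlled by the explicit Gaussian overlap, the second by the decay of 1 - t. *)
Lemma overlap_ge_mass h : exists2 K : R, 0 <= K &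
  forall n, (0 < n)%N ->
    (1 - K / Num.sqrt n%:R) * profile_mass n <= \int[vol]_k overlap n h k.
Proof.
have [C C0 decay] := svk_decay vt; have [d d0 massd] := profile_mass_ge.
pose a := norm3 h ^+ 2; have a0 : 0 <= a by exact: sqr_ge0.
have A0 : 0 <= 2 * a + 4 * C * a + 4 * expR 6.
  have := expR_ge0 (6 : R); have := mulr_ge0 C0 a0; lra.
(* The three summands come from the Gaussian overlap, from the decay outside the cube and from the
   volume of the cube; [d] converts Gaussian mass into profile mass. *)
pose K := (2 * a + 4 * C * a + 4 * expR 6) / d.
exists K.
  by rewrite divr_ge0 ?(ltW d0).
move=> n n0; have nR : 0 < n%:R :> R by rewrite ltr0n.
(* The half-side of the cube: large enough for the decay [C * a / s] to vanish outside it, small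
   enough for the volume [8 * s ^+ 3] to be negligible against the mass. *)
pose s : R := Num.sqrt n%:R; have s0 : 0 < s by rewrite sqrtr_gt0.
have sn : n%:R = s ^+ 2 by rewrite sqr_sqrtr// ltW.
have s1 : 1 <= s by rewrite -sqrtr1 ler_wsqrtr// ler1n.
have hG := has_integral_gauss_mass n0; set I := gauss_mass n in hG.
have I0 : 0 <= I := has_integral_ge0 hG.
have hGs := has_integral_shift h hG.
have hGG := has_integral_gauss_overlap h n0; rewrite -/I -/a in hGG.
set e := expR _ in hGG.
have hc := has_integral_cube (ltW s0).
have eta0 : 0 <= C * a / s.
  by apply: mulr_ge0; [exact: mulr_ge0|rewrite invr_ge0 ltW].
have c2 : 0 <= 2 :> R by []. have c4 : 0 <= 4 :> R by [].
(* The square 2 (G - G')^2 is expanded and its negative part 4 G G' moved to the left, so that only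
   nonnegative functions are integrated. *)
have lhs := has_integralD (has_integral_halves h n0) (has_integralZ c4 hGG).
have rhs := has_integralD (has_integral_overlap h n0)
  (has_integralD (has_integralZ c2 (has_integralD hG hGs))
    (has_integralZ c4 (has_integralD (has_integralZ eta0 hG) hc))).
have := has_integral_le lhs rhs _; rewrite -/s => main.
have {main}main : profile_mass n + 4 * (e * I) <=
    \int[vol]_k overlap n h k + (2 * (I + I) + 4 * (C * a / s * I + 8 * s ^+ 3)).
  apply: main => k.
  set ta := t k0 k; set tb := t k0 (k + h); set tt := t k (k + h).
  set G := gauss3 n k; set G' := gauss3 n (k + h).
  rewrite /overlap /profile -/ta -/tb -/tt -/G -/G'.
  have G0 : 0 <= G by exact: gauss3_ge0.
  have G'0 : 0 <= G' by exact: gauss3_ge0.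
  have ta0 : 0 <= ta by exact: (svk_ge0 vt).
  have ta1 : ta <= 1 by exact: (svk_le1 vt).
  have tb0 : 0 <= tb by exact: (svk_ge0 vt).
  have tb1 : tb <= 1 by exact: (svk_le1 vt).
  have tt0 : 0 <= tt by exact: (svk_ge0 vt).
  have tt1 : tt <= 1 by exact: (svk_le1 vt).
  have lip : (ta - tb) ^+ 2 <= 2 * (1 - tt) by exact: (svk_lipschitz vt).
  have small : (1 - tt) * G ^+ 2 <= C * a / s * G ^+ 2 + \1_(cube s) k.
    rewrite indicE; have [_|kC] := boolP (k \in cube s).
      have le1 : (1 - tt) * G ^+ 2 <= 1.
        apply: mulr_ile1; rewrite ?subr_ge0 ?sqr_ge0 ?gerBl//.
        by rewrite expr_le1// gauss3_le1.
      by rewrite -[leLHS]add0r; apply: lerD => //; apply: mulr_ge0 => //; exact: sqr_ge0.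
    rewrite addr0 ler_wpM2r ?sqr_ge0// ler_pdivlMr//.
    have := decay k (k + h); rewrite addrAC subrr add0r => /(le_trans _); apply.
    by rewrite ler_wpM2l ?subr_ge0// notin_cube_norm3.
  have F1 : (G * ta - G' * tb) ^+ 2 <=
      2 * ((G - G') ^+ 2 * tb ^+ 2) + 2 * (G ^+ 2 * (ta - tb) ^+ 2).
    have := sqr_ge0 ((G - G') * tb - G * (ta - tb)); lra.
  have F2 : (G - G') ^+ 2 * tb ^+ 2 <= (G - G') ^+ 2.
    by rewrite ler_piMr ?sqr_ge0// expr_le1.
  have F3 := ler_wpM2l (sqr_ge0 G) lip.
  have tt1' : 0 <= 1 - tt by rewrite subr_ge0.
  (* G G' is traded for [2 * G ^+ 2 + (G - G') ^+ 2], since the decay of [1 - tt] in [norm3 k] is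
     matched with the Gaussian at [k] alone. *)
  have F4 : (1 - tt) * (G * ta * (G' * tb)) <= (1 - tt) * (2 * G ^+ 2 + (G - G') ^+ 2).
    apply: ler_wpM2l => //; apply: (@le_trans _ _ (G * G')).
      by apply: ler_pM; rewrite ?mulr_ge0// ler_piMr.
    have := sqr_ge0 (G - G' / 2); have := sqr_ge0 G'; lra.
  have F5 : (1 - tt) * (G - G') ^+ 2 <= (G - G') ^+ 2.
    by rewrite ler_piMl ?sqr_ge0// gerBl.
  lra.
have e_ge : (1 - e) * I <= a / 2 / s * I.
  rewrite ler_wpM2r// lerBlDr -lerBlDl; apply: le_trans (expR_ge1Dx _).
  rewrite lerD2l lerN2 invfM mulrA ler_wpM2l ?divr_ge0//.
  rewrite lef_pV2 ?posrE ?exprn_gt0// sn -exprM.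
  by rewrite ler_eXnr.
have I_ge : 8 * s ^+ 3 <= expR 6 * I / s.
  rewrite ler_pdivlMr//; apply: (@le_trans _ _ (8 * s ^+ 6)).
    by rewrite -mulrA -exprSr ler_wpM2l// ler_weXn2l.
  have := ler_wpM2l (expR_ge0 6) (gauss_mass_ge n0); apply: le_trans.
  rewrite sn -exprM [leRHS](_ : _ = expR 6 * expR (- 6) * (8 * s ^+ 6)); last by ring.
  by rewrite expRxMexpNx_1 mul1r.
have KN : (2 * a + 4 * C * a + 4 * expR 6) / s * I <= K / s * profile_mass n.
  rewrite [leRHS](_ : _ = (2 * a + 4 * C * a + 4 * expR 6) / s * (profile_mass n / d)).
    rewrite ler_wpM2l//; last by rewrite ler_pdivlMr// mulrC massd.
    by rewrite divr_ge0 ?(ltW s0).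
  by rewrite /K; field; rewrite !gt_eqF.
lra.
Qed.

Definition profile_state n p : R := (Num.sqrt (profile_mass n))^-1 * profile n p.

Lemma has_integral_profile_state n : (0 < n)%N ->
  has_integral (profile_state n)
    ((Num.sqrt (profile_mass n))^-1 * \int[vol]_x profile n x).
Proof.
move=> n0; apply: has_integralZ; last exact: has_integral_profile.
by rewrite invr_ge0 sqrtr_ge0.
Qed.

Lemma has_integral_profile_state_sqr n : (0 < n)%N ->
  has_integral (fun p => profile_state n p ^+ 2) 1.
Proof.
move=> n0; have N0 := profile_mass_gt0 n0.
have i0 : 0 <= (profile_mass n)^-1 by rewrite invr_ge0 ltW.
have := has_integralZ i0 (has_integral_profile_mass n0).
rewrite mulVf ?gt_eqF//; congr has_integral; apply/funext => p.
by rewrite /profile_state [RHS]exprMn exprVn sqr_sqrtr// ltW.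
Qed.

Let ratio n h := (profile_mass n)^-1 * \int[vol]_k overlap n h k.

Let ratio_ge0 n h : (0 < n)%N -> 0 <= ratio n h.
Proof.
move=> n0; rewrite mulr_ge0 ?invr_ge0 ?(ltW (profile_mass_gt0 n0))//.
exact: has_integral_ge0 (has_integral_overlap h n0).
Qed.

Let ratio_le1 n h : (0 < n)%N -> ratio n h <= 1.
Proof.
move=> n0; rewrite /ratio mulrC ler_pdivrMr ?profile_mass_gt0// mul1r.
exact: overlap_le_mass.
Qed.

Let measurable_ratio n : measurable_fun setT (ratio n).
Proof.
apply: measurable_funM; first exact: measurable_cst.
apply: (measurableT_comp (f := fine)) => //.
apply: (measurable_fun_ge0_integral (g := overlap n)).
  move=> d T a b ma mb; apply: measurable_funM; first apply: measurable_funM.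
  - by apply: (measurable_fun_svk vt) => //; exact: measurable_funD_R3.
  - exact: (measurableT_comp (measurable_profile n)).
  - apply: (measurableT_comp (measurable_profile n)); exact: measurable_funD_R3.
by move=> h k; exact: overlap_ge0.
Qed.

Lemma ratio_cvg h : ratio n.+1 h @[n --> \oo] --> (1 : R).
Proof.
have [K K0 KP] := overlap_ge_mass h.
apply: (@squeeze_cvgr _ _ _ _ (fun n : nat => 1 - K / Num.sqrt n.+1%:R) (cst 1)).
- near=> n; rewrite ratio_le1// andbT /ratio (mulrC (profile_mass _)^-1)
    ler_pdivlMr ?profile_mass_gt0//.
  exact: KP.
- rewrite -[X in _ --> X]subr0; apply: cvgB; first exact: cvg_cst.
  rewrite -(mulr0 K); apply: cvgM; first exact: cvg_cst.
  rewrite (_ : (fun _ => _) = (fun n => Num.sqrt (harmonic n))); last first.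
    by apply/funext => n; rewrite /harmonic sqrtrV.
  rewrite -[X in _ --> X]sqrtr0.
  apply: (@cvg_comp _ _ _ (@harmonic R) (@Num.sqrt R) _ _ _ (@cvg_harmonic R)).
  exact: sqrt_continuous.
- exact: cvg_cst.
Unshelve. all: by end_near. Qed.

(** The overlap ratios lie between 0 and 1, so [cauchyw] itself is the dominating function. The
    index is shifted because division by zero makes [gauss3 0] the constant 1, which is not
    integrable. *)
Lemma smoothed_mass_cvg : exists J : nat -> R,
  (forall n, (0 < n)%N ->
    (\int[vol]_h ((cauchyw h)%:E *
      \int[vol]_k (weighted_kernel t (profile_state n) k (k + h))%:E) = (J n)%:E)%E) /\
  J n.+1 @[n --> \oo] --> ((2 * pi) ^+ 3 : R).
Proof.
have hc : has_integral (@cauchyw R) ((2 * pi) ^+ 3).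
  split; [exact: measurable_cauchyw|exact: cauchyw_ge0|exact: integral_cauchyw].
have mcr n : measurable_fun setT (fun h => cauchyw h * ratio n h).
  by apply: measurable_funM; [exact: measurable_cauchyw|exact: measurable_ratio].
have hJ n : (0 < n)%N -> has_integral (fun h => cauchyw h * ratio n h)
    (\int[vol]_h (cauchyw h * ratio n h)).
  move=> n0; apply: (has_integral_dom _ _ hc) => // h.
  - by rewrite mulr_ge0 ?cauchyw_ge0 ?ratio_ge0.
  - by rewrite ler_piMr ?cauchyw_ge0 ?ratio_le1.
exists (fun n => \int[vol]_h (cauchyw h * ratio n h)); split.
  move=> n n0; have [_ _ <-] := hJ n n0; apply: eq_integral => h _.
  rewrite [RHS]EFinM; congr (_ * _)%E.
  have N0 := profile_mass_gt0 n0.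
  have i0 : 0 <= (profile_mass n)^-1 by rewrite invr_ge0 ltW.
  have [_ _ <-] := has_integralZ i0 (has_integral_overlap h n0).
  apply: eq_integral => k _; congr EFin.
  rewrite /weighted_kernel /profile_state /overlap.
  have -> : (profile_mass n)^-1 = (Num.sqrt (profile_mass n))^-1 ^+ 2.
    by rewrite exprVn sqr_sqrtr// ltW.
  by ring.
have mEr n : measurable_fun setT (fun h => (cauchyw h * ratio n.+1 h)%:E).
  exact/measurable_EFinP.
have mEc : measurable_fun setT (EFin \o @cauchyw R).
  by apply/measurable_EFinP; exact: measurable_cauchyw.
have cv : {ae vol, forall h : V, setT h ->
    (cauchyw h * ratio n.+1 h)%:E @[n --> \oo] --> (cauchyw h)%:E}.
  apply: aeW => h _; apply: cvg_EFin; first exact: nearW.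
  rewrite -[X in _ --> X]mulr1; apply: cvgM; first exact: cvg_cst.
  exact: ratio_cvg.
have dom : {ae vol, forall (h : V) n, setT h ->
    (`|(cauchyw h * ratio n.+1 h)%:E| <= (cauchyw h)%:E)%E}.
  apply: aeW => h n _; rewrite /= lee_fin ger0_norm.
    by rewrite ler_piMr ?cauchyw_ge0 ?ratio_le1.
  by rewrite mulr_ge0 ?cauchyw_ge0 ?ratio_ge0.
have [_ _] := dominated_convergence measurableT mEr mEc cv (has_integral_integrable hc) dom.
rewrite integral_cauchyw => /fine_cvgP[_].
by apply: cvg_trans; apply: near_eq_cvg; exact: nearW.
Qed.

End gaussian_profile.

(** * Square-integrable functions and their inner product in real terms *)

Section square_integrable.
Context {R : realType}.
Notation V := (R3 R).
Notation C := R[i].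
Implicit Types (phi psi chi : V -> C).

Definition sqmod phi (k : V) : R := complex.Re (phi k) ^+ 2 + complex.Im (phi k) ^+ 2.

Definition norm2 phi : R := \int[vol]_k sqmod phi k.

Lemma sqmod_ge0 phi k : 0 <= sqmod phi k.
Proof. by rewrite addr_ge0 ?sqr_ge0. Qed.

Let normcE phi k : ComplexField.Normc.normc (phi k) = Num.sqrt (sqmod phi k).
Proof. by rewrite /sqmod; case: (phi k). Qed.

Lemma cnorm2E phi : cnorm 2%:E phi = ((\int[vol]_k (sqmod phi k)%:E) `^ 2^-1)%E.
Proof.
rewrite /cnorm unlock; congr (_ `^ _)%E; apply: eq_integral => k _.
by rewrite abse_EFin poweR_EFin powR_mulrn// ger0_norm ?normcE ?sqr_sqrtr ?sqrtr_ge0 ?sqmod_ge0.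
Qed.

Lemma cnorm1E phi : cnorm 1%:E phi = (\int[vol]_k (Num.sqrt (sqmod phi k))%:E)%E.
Proof.
rewrite /cnorm Lnorm1; apply: eq_integral => k _.
by rewrite /= normcE ger0_norm// sqrtr_ge0.
Qed.

Lemma cLfun2P phi : cLfun 2%:E phi <->
  [/\ measurable_fun setT (fun k => complex.Re (phi k)),
      measurable_fun setT (fun k => complex.Im (phi k)) &
      has_integral (sqmod phi) (norm2 phi)].
Proof.
split=> -[mRe mIm].
  rewrite cnorm2E => /lty_poweRy h; split => //; split.
  - by apply: measurable_funD; exact: measurable_funX.
  - exact: sqmod_ge0.
  - rewrite /norm2 /Rintegral fineK// ge0_fin_numE; first exact: h.
    by apply: integral_ge0 => k _; rewrite lee_fin sqmod_ge0.
by move=> [_ _ E]; split => //; rewrite cnorm2E E poweR_lty// ltry.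
Qed.

Lemma norm2_ge0 phi : 0 <= norm2 phi.
Proof. by apply: Rintegral_ge0 => k _; exact: sqmod_ge0. Qed.

Lemma cnorm2_sqrt phi : cLfun 2%:E phi -> cnorm 2%:E phi = (Num.sqrt (norm2 phi))%:E.
Proof.
move=> /cLfun2P[_ _ [_ _ E]].
by rewrite cnorm2E E poweR_EFin powR12_sqrt// norm2_ge0.
Qed.

(** With [crossc], the real and imaginary parts of [(phi k)^* * psi k]: complex integrals become
    pairs of real ones. *)
Definition dotc phi psi (k : V) : R :=
  complex.Re (phi k) * complex.Re (psi k) + complex.Im (phi k) * complex.Im (psi k).

Definition crossc phi psi (k : V) : R :=
  complex.Re (phi k) * complex.Im (psi k) - complex.Im (phi k) * complex.Re (psi k).

Lemma Re_inner phi psi : complex.Re (inner phi psi) = \int[vol]_k dotc phi psi k.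
Proof.
apply: eq_Rintegral => k _; rewrite /dotc.
by case: (phi k) (psi k) => [a b] [c d] /=; ring.
Qed.

Lemma Im_inner phi psi : complex.Im (inner phi psi) = \int[vol]_k crossc phi psi k.
Proof.
apply: eq_Rintegral => k _; rewrite /crossc.
by case: (phi k) (psi k) => [a b] [c d] /=; ring.
Qed.

Lemma Re_inner_self phi : complex.Re (inner phi phi) = norm2 phi.
Proof. by rewrite Re_inner; apply: eq_Rintegral => k _; rewrite /dotc -!expr2. Qed.

Lemma measurable_dotc phi psi : cLfun 2%:E phi -> cLfun 2%:E psi ->
  measurable_fun setT (dotc phi psi).
Proof.
move=> [mr1 mi1 _] [mr2 mi2 _].
by apply: measurable_funD; exact: measurable_funM.
Qed.

Lemma measurable_crossc phi psi : cLfun 2%:E phi -> cLfun 2%:E psi ->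
  measurable_fun setT (crossc phi psi).
Proof.
move=> [mr1 mi1 _] [mr2 mi2 _].
by apply: measurable_funB; exact: measurable_funM.
Qed.

Let integrable_sqmodD phi psi : cLfun 2%:E phi -> cLfun 2%:E psi ->
  vol.-integrable setT (EFin \o (fun k => sqmod phi k + sqmod psi k)).
Proof.
move=> /cLfun2P[_ _ h1] /cLfun2P[_ _ h2].
exact: has_integral_integrable (has_integralD h1 h2).
Qed.

Lemma integrable_dotc phi psi : cLfun 2%:E phi -> cLfun 2%:E psi ->
  vol.-integrable setT (EFin \o dotc phi psi).
Proof.
move=> L1 L2; apply: (le_integrable measurableT _ _ (integrable_sqmodD L1 L2)).
  by apply/measurable_EFinP; exact: measurable_dotc.
move=> k _ /=; rewrite lee_fin [leRHS]ger0_norm; last first.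
  by apply: addr_ge0; exact: sqmod_ge0.
rewrite /dotc /sqmod; case: (phi k) (psi k) => [a b] [c d] /=; rewrite ler_norml.
have := sqr_ge0 (a + c); have := sqr_ge0 (b + d).
have := sqr_ge0 (a - c); have := sqr_ge0 (b - d).
have := sqr_ge0 a; have := sqr_ge0 b; have := sqr_ge0 c; have := sqr_ge0 d.
by move=> *; apply/andP; split; lra.
Qed.

Lemma integrable_crossc phi psi : cLfun 2%:E phi -> cLfun 2%:E psi ->
  vol.-integrable setT (EFin \o crossc phi psi).
Proof.
move=> L1 L2; apply: (le_integrable measurableT _ _ (integrable_sqmodD L1 L2)).
  by apply/measurable_EFinP; exact: measurable_crossc.
move=> k _ /=; rewrite lee_fin [leRHS]ger0_norm; last first.
  by apply: addr_ge0; exact: sqmod_ge0.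
rewrite /crossc /sqmod; case: (phi k) (psi k) => [a b] [c d] /=; rewrite ler_norml.
have := sqr_ge0 (a + d); have := sqr_ge0 (b + c).
have := sqr_ge0 (a - d); have := sqr_ge0 (b - c).
have := sqr_ge0 a; have := sqr_ge0 b; have := sqr_ge0 c; have := sqr_ge0 d.
by move=> *; apply/andP; split; lra.
Qed.

Lemma inner_aeq phi psi chi : cLfun 2%:E phi -> cLfun 2%:E psi -> cLfun 2%:E chi ->
  aeq psi chi -> inner phi psi = inner phi chi.
Proof.
move=> L1 L2 L3 ae23.
have E : complex.Re (inner phi psi) = complex.Re (inner phi chi) /\
    complex.Im (inner phi psi) = complex.Im (inner phi chi).
  rewrite !Re_inner !Im_inner; split; congr fine; apply: ae_eq_integral => //.
  - by apply/measurable_EFinP; exact: measurable_dotc.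
  - by apply/measurable_EFinP; exact: measurable_dotc.
  - by apply: filterS ae23 => k + _; rewrite /dotc => ->.
  - by apply/measurable_EFinP; exact: measurable_crossc.
  - by apply/measurable_EFinP; exact: measurable_crossc.
  - by apply: filterS ae23 => k + _; rewrite /crossc => ->.
by move: E; case: (inner phi psi) (inner phi chi) => [a b] [c d] /= [-> ->].
Qed.

Lemma cLfun2_lin (a : C) phi psi : cLfun 2%:E phi -> cLfun 2%:E psi ->
  cLfun 2%:E (fun k => a * phi k + psi k).
Proof.
move=> /cLfun2P[mr1 mi1 h1] /cLfun2P[mr2 mi2 h2]; case: a => x y.
have ReE k : complex.Re ((x +i* y) * phi k + psi k) =
    x * complex.Re (phi k) - y * complex.Im (phi k) + complex.Re (psi k).
  by case: (phi k) (psi k) => [? ?] [? ?].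
have ImE k : complex.Im ((x +i* y) * phi k + psi k) =
    x * complex.Im (phi k) + y * complex.Re (phi k) + complex.Im (psi k).
  by case: (phi k) (psi k) => [? ?] [? ?].
have mR : measurable_fun setT (fun k => complex.Re ((x +i* y) * phi k + psi k)).
  under eq_fun do rewrite ReE.
  apply: measurable_funD => //; apply: measurable_funB; apply: measurable_funM => //;
    exact: measurable_cst.
have mI : measurable_fun setT (fun k => complex.Im ((x +i* y) * phi k + psi k)).
  under eq_fun do rewrite ImE.
  apply: measurable_funD => //; apply: measurable_funD; apply: measurable_funM => //;
    exact: measurable_cst.
apply/cLfun2P; split => //.
(* The dominating function comes from |u + v|^2 <= 2 |u|^2 + 2 |v|^2. *)
have c0 : 0 <= 2 * (x ^+ 2 + y ^+ 2) by rewrite mulr_ge0// addr_ge0 ?sqr_ge0.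
have c2 : 0 <= 2 :> R by [].
apply: (has_integral_dom _ _ (has_integralD (has_integralZ c0 h1) (has_integralZ c2 h2))).
- by apply: measurable_funD; exact: measurable_funX.
- by move=> k; exact: sqmod_ge0.
move=> k; rewrite /sqmod ReE ImE.
case: (phi k) (psi k) => [a b] [c d] /=.
have := sqr_ge0 (x * a - y * b - c); have := sqr_ge0 (x * b + y * a - d); lra.
Qed.

End square_integrable.

(** * Convergence in the complex field and in the reals *)

Section real_sequences.
Context {R : realType}.

Lemma cvg_real_complex (r : nat -> R) (l : R) : r n @[n --> \oo] --> l ->
  (fun n => (r n)%:C : R[i]^o) @ \oo --> (l%:C : R[i]^o).
Proof.
(* A positive element of [R[i]] is real, so the complex tolerance reduces to its real part. *)
move=> rl; apply/cvgrPdist_lt => -[e1 e2]; rewrite ltcE/= => /andP[/eqP e20 e10].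
move/cvgrPdist_lt : rl => /(_ _ e10); apply: filterS => n h.
rewrite -rmorphB normc_def/= expr0n addr0 sqrtr_sqr ltcE/=.
by rewrite -e20 eqxx.
Qed.

Lemma cvg_Re (u : nat -> R[i]) (l : R[i]) :
  (fun n => u n : R[i]^o) @ \oo --> (l : R[i]^o) ->
  complex.Re (u n) @[n --> \oo] --> complex.Re l.
Proof.
move=> ul; apply/cvgrPdist_lt => e e0.
have e0' : 0 < e%:C :> R[i] by rewrite ltcE/= eqxx.
move/cvgrPdist_lt : ul => /(_ _ e0'); apply: filterS => n h.
have := le_lt_trans (normc_ge_Re _) h.
rewrite ltcE/= => /andP[_].
by case: l (u n) {h} => [a b] [c d].
Qed.

End real_sequences.

(** * Positivity, monotonicity and contractivity of a POL *)

Section pol.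
Context {R : realType}.
Notation V := (R3 R).
Notation C := R[i].
Variable T : set V -> (V -> C) -> (V -> C).
Hypothesis PT : POL T.

Let TL D phi : measurable D -> cLfun 2%:E phi -> cLfun 2%:E (T D phi).
Proof. by move=> mD; case: (POL_bounded PT mD) => + _ _ _; exact. Qed.

Lemma inner_setT phi : cLfun 2%:E phi -> complex.Re (inner phi (T setT phi)) = norm2 phi.
Proof.
move=> L; rewrite -Re_inner_self; congr complex.Re.
by apply: inner_aeq => //; [exact: TL|exact: POL_normalized].
Qed.

Lemma inner_pos D phi : measurable D -> cLfun 2%:E phi ->
  complex.Im (inner phi (T D phi)) = 0 /\ 0 <= complex.Re (inner phi (T D phi)).
Proof.
move=> mD L; have := POL_positive PT mD L.
by rewrite lecE/= => /andP[/eqP -> ->].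
Qed.

(** Additivity is applied to [D], its complement and then empty sets. By positivity every nonempty
    partial sum is at least the term of [D], hence so is the limit, which belongs to the whole
    space. *)
Lemma inner_le_norm2 D phi : measurable D -> cLfun 2%:E phi ->
  complex.Re (inner phi (T D phi)) <= norm2 phi.
Proof.
move=> mD L; rewrite -inner_setT//.
have mB n : measurable (bigcup2 D (~` D) n).
  by case: n => [//|[|n]] /=; [exact: measurableC|exact: measurable0].
have := POL_sigma_additive PT mB _ L L.
rewrite bigcup2E setUv => /(_ _)/cvg_Re.
have ReS n : complex.Re (\sum_(i < n) inner phi (T (bigcup2 D (~` D) i) phi)) =
    \sum_(i < n) complex.Re (inner phi (T (bigcup2 D (~` D) i) phi)).
  apply: (big_ind2 (fun (z : C) (r : R) => complex.Re z = r)) => //.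
  by move=> [a b] r [c d] s /= <- <-.
move=> /(_ _)/cvgr_to_ge; apply.
  by rewrite -trivIset_bigcup2 setICr.
exists 1%N => // n /= n0; rewrite ReS -(prednK n0) big_ord_recl/= lerDl.
by apply: sumr_ge0 => i _; have [] := inner_pos (mB (lift ord0 i)) L.
Qed.

(* Positivity of [T D] on [phi - T D phi], where the cross terms are evaluated
   through the reality of the form on [phi + i (T D phi)]. *)
Lemma POL_contraction D phi : measurable D -> cLfun 2%:E phi ->
  norm2 (T D phi) <= norm2 phi.
Proof.
move=> mD L; pose psi := T D phi.
have Lpsi : cLfun 2%:E psi by exact: TL.
have LTpsi : cLfun 2%:E (T D psi) by exact: TL.
have lin (a : C) : inner (fun k => a * psi k + phi k) (T D (fun k => a * psi k + phi k)) =
    inner (fun k => a * psi k + phi k) (fun k => a * T D psi k + psi k).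
  apply: inner_aeq.
  - exact: cLfun2_lin.
  - by apply: TL => //; exact: cLfun2_lin.
  - exact: cLfun2_lin.
  - by case: (POL_bounded PT mD) => _ _ + _; exact.
have pos a := inner_pos mD (cLfun2_lin a Lpsi L).
have [Im1 _] := inner_pos mD L; have [Im2 _] := inner_pos mD Lpsi.
have le1 := inner_le_norm2 mD L; have le2 := inner_le_norm2 mD Lpsi.
have intE (f g h k : V -> R) : vol.-integrable setT (EFin \o f) ->
    vol.-integrable setT (EFin \o g) -> vol.-integrable setT (EFin \o h) ->
    vol.-integrable setT (EFin \o k) ->
    \int[vol]_x (f x + g x - h x + k x) =
    \int[vol]_x f x + \int[vol]_x g x - \int[vol]_x h x + \int[vol]_x k x.
  move=> jf jg jh jk; rewrite RintegralD//; last first.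
    exact: (integrableB measurableT (integrableD measurableT jf jg) jh).
  by rewrite RintegralB//; [rewrite RintegralD|exact: (integrableD measurableT jf jg)].
have [Im3 _] := pos (0 +i* 1); rewrite lin Im_inner in Im3.
have re_sym : \int[vol]_x dotc phi (T D psi) x = norm2 psi.
  move: Im3; rewrite (@eq_Rintegral _ _ _ vol setT (fun x =>
    crossc phi psi x + crossc psi (T D psi) x -
    dotc psi psi x + dotc phi (T D psi) x)); last first.
    move=> x _; rewrite /crossc /dotc.
    by case: (phi x) (psi x) (T D psi x) => [a b] [c d] [e f] /=; ring.
  rewrite intE; first last.
  - exact: integrable_dotc.
  - exact: integrable_dotc.
  - exact: integrable_crossc.
  - exact: integrable_crossc.
  by rewrite -!Im_inner Im1 Im2 -Re_inner Re_inner_self; lra.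
have [_] := pos ((-1) +i* 0); rewrite lin Re_inner.
rewrite (@eq_Rintegral _ _ _ vol setT (fun x => dotc phi psi x + dotc psi (T D psi) x -
    (dotc psi psi x + dotc phi (T D psi) x) + 0)); last first.
  move=> x _; rewrite /dotc.
  by case: (phi x) (psi x) (T D psi x) => [a b] [c d] [e f] /=; ring.
rewrite intE; first last.
- exact: integrable0.
- exact: (integrableD measurableT (integrable_dotc Lpsi Lpsi) (integrable_dotc L LTpsi)).
- exact: integrable_dotc.
- exact: integrable_dotc.
rewrite RintegralD//; last 2 first.
- exact: integrable_dotc.
- exact: integrable_dotc.
(* What remains is 2 |psi|^2 <= <phi, psi> + <psi, T D psi>, in real parts, and [le1], [le2] bound
   the right-hand side by |phi|^2 + |psi|^2. *)
rewrite re_sym -!Re_inner Re_inner_self Rintegral_cst// mul0r.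
by rewrite -/psi in le1 *; lra.
Qed.

End pol.

(** * States with a phase: the quadratic form of the POL as a density *)

Section phased.
Context {R : realType}.
Notation V := (R3 R).
Notation C := R[i].
Variables (f : V -> R) (b : V) (a : R).
Hypotheses (f0 : forall p, 0 <= f p) (hf : has_integral f a).
Hypothesis hf2 : has_integral (fun p => f p ^+ 2) 1.

Definition phased (p : V) : C := cis (- dot3 b p) * (f p)%:C.

Let mf : measurable_fun setT f := let: And3 mf _ _ := hf in mf.

Let Re_phased p : complex.Re (phased p) = cos (- dot3 b p) * f p.
Proof. by rewrite /phased /cis /=; ring. Qed.

Let Im_phased p : complex.Im (phased p) = sin (- dot3 b p) * f p.
Proof. by rewrite /phased /cis /=; ring. Qed.

Lemma sqmod_phased p : sqmod phased p = f p ^+ 2.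
Proof. by rewrite /sqmod Re_phased Im_phased !exprMn -mulrDl cos2Dsin2 mul1r. Qed.

Let mdot : measurable_fun setT (fun p : V => - dot3 b p).
Proof.
by apply: measurable_funN; apply: measurable_fun_dot3 => //; exact: measurable_cst.
Qed.

Let mRe : measurable_fun setT (fun p => complex.Re (phased p)).
Proof.
under eq_fun do rewrite Re_phased; apply: measurable_funM => //.
apply: (measurableT_comp (f := @cos R)) => //.
by apply: continuous_measurable_fun; exact: continuous_cos.
Qed.

Let mIm : measurable_fun setT (fun p => complex.Im (phased p)).
Proof.
under eq_fun do rewrite Im_phased; apply: measurable_funM => //.
apply: (measurableT_comp (f := @sin R)) => //.
by apply: continuous_measurable_fun; exact: continuous_sin.
Qed.

Lemma cLfun1_phased : cLfun 1%:E phased.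
Proof.
split => //; rewrite cnorm1E.
under eq_integral do rewrite sqmod_phased sqrtr_sqr ger0_norm//.
by have [_ _ ->] := hf; rewrite ltry.
Qed.

Lemma norm2_phased : norm2 phased = 1.
Proof.
rewrite -(has_integral_Rintegral hf2).
by apply: eq_Rintegral => p _; rewrite sqmod_phased.
Qed.

Lemma cLfun2_phased : cLfun 2%:E phased.
Proof.
apply/cLfun2P; split => //; rewrite norm2_phased.
by have := hf2; congr has_integral; apply/funext => p; rewrite sqmod_phased.
Qed.

Lemma is_state_phased : is_state phased.
Proof.
split; first exact: cLfun2_phased.
by rewrite cnorm2_sqrt ?norm2_phased ?sqrtr1//; exact: cLfun2_phased.
Qed.

(** The two phases multiply to e^(-ib(p-k)), which turns x into x - b in the Fourier factor. *)
Lemma Re_kernel_phased (t : V -> V -> R) x p k :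
  complex.Re ((t k p)%:C * cis (dot3 (p - k) x) * (phased k)^* * phased p) =
  weighted_kernel t f k p * cos (dot3 (p - k) (x - b)).
Proof.
rewrite (_ : dot3 (p - k) (x - b) = dot3 (p - k) x + (dot3 b k - dot3 b p)); last first.
  by rewrite /dot3/=; ring.
rewrite /weighted_kernel /phased /cis /= !cosN !sinN cosD cosB sinB; ring.
Qed.

Variables (T : set V -> (V -> C) -> (V -> C)) (t : V -> V -> R).
Hypotheses (PT : POL T) (kT : has_kernel T (fun k p => (t k p)%:C)).

Let Re_cint D (g : V -> C) :
  complex.Re (cint D g) = \int[vol]_(x in D) complex.Re (g x).
Proof. by []. Qed.

(** [cint] is defined componentwise, so the real part passes through all three integrals without any
    integrability argument. *)
Lemma Re_inner_kernel D : measurable D ->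
  complex.Re (inner phased (T D phased)) =
  (2 * pi) ^- 3 * \int[vol]_(x in D) density t f (x - b).
Proof.
move=> mD; rewrite (kT cLfun1_phased cLfun2_phased mD).
pose F x p k := (t k p)%:C * cis (dot3 (p - k) x) * (phased k)^* * phased p.
have FkE x p : complex.Re (cint setT (F x p)) = slice_transform t f p (x - b).
  by rewrite Re_cint; apply: eq_Rintegral => k _; exact: Re_kernel_phased.
have FpE x : complex.Re (cint setT (fun p => cint setT (F x p))) = density t f (x - b).
  by rewrite Re_cint; apply: eq_Rintegral => p _; exact: FkE.
have FE : complex.Re (cint D (fun x => cint setT (fun p => cint setT (F x p)))) =
    \int[vol]_(x in D) density t f (x - b).
  by rewrite Re_cint; apply: eq_Rintegral => x _; exact: FpE.
rewrite -FE -/(F _ _ _); case: (cint D _) => u v /=; ring.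
Qed.

Lemma total_density : \int[vol]_x density t f (x - b) = (2 * pi) ^+ 3.
Proof.
have := Re_inner_kernel measurableT; rewrite (inner_setT PT cLfun2_phased) norm2_phased.
have C30 : (2 * pi) ^+ 3 != 0 :> R by rewrite gt_eqF// exprn_gt0// mulr_gt0// pi_gt0.
by move=> /(congr1 (fun z => (2 * pi) ^+ 3 * z)); rewrite mulr1 mulVKf.
Qed.

Hypothesis vt : slowly_varying_kernel t.

Lemma inner_ball_bounds (r J : R) : 0 < r ->
  (\int[vol]_h ((cauchyw h)%:E * \int[vol]_k (weighted_kernel t f k (k + h))%:E) = J%:E)%E ->
  (J / (2 * pi) ^+ 3 - expR (- r)) / (1 - expR (- r)) <=
    complex.Re (inner phased (T (open_ball b r) phased)) <= 1.
Proof.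
move=> r0 JE; have C30 : 0 < (2 * pi) ^+ 3 :> R by rewrite exprn_gt0// mulr_gt0// pi_gt0.
have e1 : 0 < 1 - expR (- r) by rewrite subr_gt0 expR_lt1 oppr_lt0.
have intf := has_integral_integrable hf.
have mB := measurable_open_ball b r.
rewrite -[X in _ <= _ <= X]norm2_phased (inner_le_norm2 PT mB cLfun2_phased) andbT.
rewrite Re_inner_kernel// ler_pdivrMr// lerBlDr ler_pdivrMr//.
apply: (le_trans (ball_density_ge vt f0 mf intf (ltW r0) total_density JE)).
move: C30; set P := (2 * pi) ^+ 3 => C30.
rewrite le_eqVlt; apply/orP; left; apply/eqP.
by field; rewrite gt_eqF.
Qed.

End phased.

(** * Localization of the sequence and the norm of a ball operator *)

Section localized.
Context {R : realType}.
Notation V := (R3 R).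
Notation C := R[i].
Variables (T : set V -> (V -> C) -> (V -> C)) (t : V -> V -> R).
Hypotheses (PT : POL T) (kT : has_kernel T (fun k p => (t k p)%:C)).
Hypothesis vt : slowly_varying_kernel t.
Variables (k0 b : V).

Let loc_rawE n : loc_raw t k0 b n = phased (profile t k0 n) b.
Proof. by []. Qed.

Lemma loc_constE n : (0 < n)%N ->
  loc_const t k0 b n = (Num.sqrt (profile_mass t k0 n))^-1.
Proof.
move=> n0; have [_ _ E] := has_integral_profile_mass vt k0 n0.
rewrite /loc_const loc_rawE cnorm2E.
under eq_integral do rewrite sqmod_phased.
by rewrite E poweR_EFin powR12_sqrt// ltW// profile_mass_gt0.
Qed.

Lemma loc_seqE n : (0 < n)%N -> loc_seq t k0 b n = phased (profile_state t k0 n) b.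
Proof.
move=> n0; apply/funext => p; rewrite /loc_seq loc_constE// loc_rawE.
by rewrite /phased /profile_state mulrCA -rmorphM.
Qed.

Let state_ge0 n p : 0 <= profile_state t k0 n p.
Proof. by apply: mulr_ge0; [rewrite invr_ge0 sqrtr_ge0|exact: profile_ge0]. Qed.

Lemma loc_seq_state n : (0 < n)%N ->
  0 < loc_const t k0 b n /\ is_state (loc_seq t k0 b n).
Proof.
move=> n0; split; first by rewrite loc_constE// invr_gt0 sqrtr_gt0 profile_mass_gt0.
rewrite loc_seqE//.
exact: (is_state_phased b (has_integral_profile_state vt k0 n0)
  (has_integral_profile_state_sqr vt k0 n0)).
Qed.

Lemma Re_inner_ball_cvg (r : R) : 0 < r ->
  complex.Re (inner (loc_seq t k0 b n.+1) (T (open_ball b r) (loc_seq t k0 b n.+1)))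
    @[n --> \oo] --> (1 : R).
Proof.
move=> r0; have [J [JE Jcvg]] := smoothed_mass_cvg vt k0.
have C30 : (2 * pi) ^+ 3 != 0 :> R by rewrite gt_eqF// exprn_gt0// mulr_gt0// pi_gt0.
have e1 : 1 - expR (- r) != 0 by rewrite gt_eqF// subr_gt0 expR_lt1 oppr_lt0.
apply: (@squeeze_cvgr _ _ _ _
  (fun n : nat => (J n.+1 / (2 * pi) ^+ 3 - expR (- r)) / (1 - expR (- r))) (cst 1)).
- near=> n; rewrite loc_seqE//.
  exact: (inner_ball_bounds b (state_ge0 n.+1) (has_integral_profile_state vt k0 (ltn0Sn n))
    (has_integral_profile_state_sqr vt k0 (ltn0Sn n)) PT kT vt r0 (JE _ (ltn0Sn n))).
- have E : ((2 * pi) ^+ 3 / (2 * pi) ^+ 3 - expR (- r)) / (1 - expR (- r)) = 1 :> R.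
    by rewrite divff// divff.
  rewrite -[X in _ --> X]E.
  apply: cvgM; last exact: cvg_cst.
  by apply: cvgB; [apply: cvgM => //; exact: cvg_cst|exact: cvg_cst].
- exact: cvg_cst.
Unshelve. all: by end_near. Qed.

Lemma loc_seq_localized : localized_at T b (loc_seq t k0 b).
Proof.
move=> r r0; have mB := measurable_open_ball b r.
have innerE n : (0 < n)%N ->
    inner (loc_seq t k0 b n) (T (open_ball b r) (loc_seq t k0 b n)) =
    (complex.Re (inner (loc_seq t k0 b n) (T (open_ball b r) (loc_seq t k0 b n))))%:C.
  move=> n0; have [_ [L _]] := loc_seq_state n0.
  by have [+ _] := inner_pos PT mB L; case: (inner _ _) => u v /= ->.
(* The term n = 0 is dropped, as the states are controlled for positive n only. *)
rewrite -cvg_shiftS/=.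
apply: cvg_trans (cvg_real_complex (Re_inner_ball_cvg r0)).
by apply: near_eq_cvg; apply: nearW => n; rewrite innerE.
Qed.

(** For a unit vector phi with image psi, 2 Re <phi, psi> <= 1 + |psi|^2 gives |psi|^2 >= 2 u - 1,
    where u, the real part of <phi, psi>, tends to 1 along the localized sequence; this takes the
    place of Cauchy-Schwarz. *)
Lemma opnorm_ball (r : R) : 0 < r -> opnorm (T (open_ball b r)) = 1%E.
Proof.
move=> r0; have mB := measurable_open_ball b r.
have TL phi : cLfun 2%:E phi -> cLfun 2%:E (T (open_ball b r) phi).
  by case: (POL_bounded PT mB) => + _ _ _; exact.
apply/eqP; rewrite eq_le; apply/andP; split.
  apply: ge_ereal_sup => _ [phi [L phi1] <-]; apply: le_trans phi1.
  rewrite !cnorm2_sqrt//; last exact: TL.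
  by rewrite lee_fin ler_wsqrtr// POL_contraction.
pose u n := complex.Re (inner (loc_seq t k0 b n.+1) (T (open_ball b r) (loc_seq t k0 b n.+1))).
have ucvg : 2 * u n - 1 @[n --> \oo] --> (1 : R).
  have E : 2 * 1 - 1 = 1 :> R by ring.
  rewrite -[X in _ --> X]E.
  apply: cvgB; last exact: cvg_cst.
  by apply: cvgM; [exact: cvg_cst|exact: Re_inner_ball_cvg].
have ule n : ((2 * u n - 1)%:E <= opnorm (T (open_ball b r)))%E.
  have [_ [L L1]] := loc_seq_state (ltn0Sn n).
  set phi := loc_seq _ _ _ _ in L L1; set psi := T (open_ball b r) phi.
  have Lpsi : cLfun 2%:E psi by exact: TL.
  have N1 : norm2 phi = 1.
    move: L1; rewrite cnorm2_sqrt// => -[]/(congr1 (fun z => z ^+ 2)).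
    by rewrite sqr_sqrtr ?norm2_ge0// expr1n.
  apply: (@le_trans _ _ (cnorm 2%:E psi)); last first.
    by apply: ereal_sup_ubound; exists phi => //; split => //; rewrite L1.
  rewrite cnorm2_sqrt// lee_fin.
  have psi1 : norm2 psi <= 1 by rewrite -N1; exact: POL_contraction.
  (* The estimate concerns the squared norm; as the norm is at most 1 by contractivity, it dominates
     its square. *)
  apply: (@le_trans _ _ (norm2 psi)); last first.
    rewrite -[X in X <= _]sqr_sqrtr ?norm2_ge0// expr2 ler_piMr ?sqrtr_ge0//.
    by rewrite -[leRHS]sqrtr1 ler_wsqrtr.
  rewrite /u -/phi -/psi Re_inner.
  have /cLfun2P[_ _ h1] := L; have /cLfun2P[_ _ h2] := Lpsi.
  rewrite N1 in h1.
  have i1 := has_integral_integrable (has_integralD h1 h2).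
  have := @le_Rintegral _ _ R vol setT (fun k => 2 * dotc phi psi k)
    (fun k => sqmod phi k + sqmod psi k) measurableT _ i1 _.
  rewrite (has_integral_Rintegral (has_integralD h1 h2)) RintegralZl//; last first.
    exact: integrable_dotc.
  move=> h; rewrite lerBlDl; apply: h.
    rewrite (_ : _ \o _ = (fun k => 2%:E * (dotc phi psi k)%:E)%E); last exact/funext.
    by apply: integrableZl => //; exact: integrable_dotc.
  move=> k _; rewrite /dotc /sqmod.
  have := sqr_ge0 (complex.Re (phi k) - complex.Re (psi k)).
  have := sqr_ge0 (complex.Im (phi k) - complex.Im (psi k)); lra.
move: ule; case: (opnorm _) => [s ule|_|ule]; last 2 first.
- exact: leey.
- by have := ule 0%N.
rewrite lee_fin; apply: (cvgr_to_le ucvg).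
by apply: nearW => n; rewrite -lee_fin.
Qed.

End localized.

Theorem mainTheorem18 (R : realType) (m : R) (hm : 0 < m)
    (TTM Ttct : set (R3 R) -> (R3 R -> R[i]) -> (R3 R -> R[i]))
    (hTM : POL TTM) (hTMt : has_kernel TTM (fun k p => (tTM m k p)%:C))
    (htct : POL Ttct) (htctt : has_kernel Ttct (fun k p => (ttct m k p)%:C)) :
  (POL_separated TTM /\ POL_separated Ttct) /\
  (forall (T : set (R3 R) -> (R3 R -> R[i]) -> (R3 R -> R[i]))
          (t : R3 R -> R3 R -> R),
     (T = TTM /\ t = tTM m) \/ (T = Ttct /\ t = ttct m) ->
     forall k0 b : R3 R, k0 <> 0 ->
       (forall n : nat, (0 < n)%N ->
          0 < loc_const t k0 b n /\ is_state (loc_seq t k0 b n)) /\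
       localized_at T b (loc_seq t k0 b)).
Proof.
have vTM := slowly_varying_tTM hm; have vtct := slowly_varying_ttct hm.
split; first split.
(* Separation does not mention a base momentum; the origin is taken. *)
- by move=> b r r0; exact: (opnorm_ball hTM hTMt vTM 0 b r0).
- by move=> b r r0; exact: (opnorm_ball htct htctt vtct 0 b r0).
move=> T t Tt k0 b _.
have [PT kT vt] : [/\ POL T, has_kernel T (fun k p => (t k p)%:C) & slowly_varying_kernel t].
  by case: Tt => -[-> ->].
split; first by move=> n; exact: loc_seq_state.
exact: loc_seq_localized.
Qed.
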